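(* Let $G$ be an swm-graph and let $G^*$ be its barycentric graph with the Hasse orientation $o^*$. Then $G^*$ is an orientable modular graph and $o^*$ is an admissible orientation of $G^*$. Moreover, if edges of $G$ have length $1$ and edges of $G^*$ have length $1/2$, the map $p\mapsto\{p\}$ is an isometric embedding of $G$ into $G^*$, i.e. $\tfrac12 d_{G^*}(\{p\},\{q\})=d_G(p,q)$ for all vertices $p,q$, where $d_{G^*}$ is the usual graph distance of $G^*$.
   Context: Graphs are simple, undirected, connected, possibly infinite; $I(u,v)=\{x:d(u,x)+d(x,v)=d(u,v)\}$. Weakly modular: for every vertex $u$, (TC) for $v,w$ with $1=d(v,w)<d(u,v)=d(u,w)$ there is a common neighbor $x$ of $v,w$ with $d(u,x)=d(u,v)-1$, and (QC) for $v,w,z$ with $d(v,z)=d(w,z)=1$, $2=d(v,w)\le d(u,v)=d(u,w)=d(u,z)-1$ there is a common neighbor $x$ of $v,w$ with $d(u,x)=d(u,v)-1$. An swm-graph is a weakly modular graph with no induced $K_4^-$ and no isometric $K_{3,3}^-$. A vertex set $X$ is gated if every vertex $x$ has $x'\in X$ with $x'\in I(x,y)$ for all $y\in X$. A graph is thick if for every $u,v$ at distance $2$, $I(u,v)$ contains an induced $4$--cycle. A set $X$ is Boolean-gated if it is gated and induces a thick subgraph. $\mathcal B(G)$ is the set of Boolean-gated sets of finite diameter, partially ordered by reverse inclusion; the barycentric graph $G^*$ is the covering graph of this poset, and the Hasse orientation $o^*$ orients each edge from the covering element to the covered one. A graph is modular if every triple $u,v,w$ has $I(u,v)\cap I(v,w)\cap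 I(w,u)\ne\emptyset$. An orientation of a modular graph is admissible if for every induced $4$--cycle $x_1x_2x_3x_4$ (indices mod $4$) one has $x_i\to x_{i+1}$ iff $x_{i+3}\to x_{i+2}$; a modular graph is orientable if it has an admissible orientation. *)

(* Defs.v *)
From Stdlib Require Import Arith Lia ClassicalEpsilon.

Set Implicit Arguments.

Section Graphs.
Variable V : Type.
Variable adj : V -> V -> Prop.

Inductive walk : nat -> V -> V -> Prop :=
| walk0 x : walk 0 x x
| walkS n x y z : adj x y -> walk n y z -> walk (S n) x z.

Definition connected : Prop := forall u v, exists n, walk n u v.

Definition is_graph : Prop :=
  (forall x y, adj x y -> adj y x) /\ (forall x, ~ adj x x) /\ connected.

Definition is_dist (u v : V) (n : nat) : Prop :=
  walk n u v /\ forall m, walk m u v -> n <= m.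

(* usual graph distance (meaningful for connected graphs) *)
Definition dist (u v : V) : nat := epsilon (inhabits 0) (is_dist u v).

Definition interval (u v x : V) : Prop := dist u x + dist x v = dist u v.

Definition TC_at (u : V) : Prop :=
  forall v w, dist v w = 1 -> dist u v = dist u w -> 1 < dist u v ->
    exists x, adj x v /\ adj x w /\ dist u x = dist u v - 1.

Definition QC_at (u : V) : Prop :=
  forall v w z, dist v z = 1 -> dist w z = 1 -> dist v w = 2 ->
    2 <= dist u v -> dist u v = dist u w -> dist u v = dist u z - 1 ->
    exists x, adj x v /\ adj x w /\ dist u x = dist u v - 1.

Definition weakly_modular : Prop := forall u, TC_at u /\ QC_at u.

Definition induced_K4minus (a b c d : V) : Prop :=
  adj a b /\ adj a c /\ adj a d /\ adj b c /\ adj b d /\ ~ adj c d /\ c <> d.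

Definition isometric_K33minus (a1 a2 a3 b1 b2 b3 : V) : Prop :=
  dist a1 b2 = 1 /\ dist a1 b3 = 1 /\
  dist a2 b1 = 1 /\ dist a2 b2 = 1 /\ dist a2 b3 = 1 /\
  dist a3 b1 = 1 /\ dist a3 b2 = 1 /\ dist a3 b3 = 1 /\
  dist a1 b1 = 3 /\
  dist a1 a2 = 2 /\ dist a1 a3 = 2 /\ dist a2 a3 = 2 /\
  dist b1 b2 = 2 /\ dist b1 b3 = 2 /\ dist b2 b3 = 2.

Definition swm_graph : Prop :=
  is_graph /\ weakly_modular /\
  (forall a b c d, ~ induced_K4minus a b c d) /\
  (forall a1 a2 a3 b1 b2 b3, ~ isometric_K33minus a1 a2 a3 b1 b2 b3).

Definition gated (X : V -> Prop) : Prop :=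
  forall x, exists x', X x' /\ forall y, X y -> interval x y x'.

Definition induced_C4 (x1 x2 x3 x4 : V) : Prop :=
  adj x1 x2 /\ adj x2 x3 /\ adj x3 x4 /\ adj x4 x1 /\
  ~ adj x1 x3 /\ ~ adj x2 x4 /\ x1 <> x3 /\ x2 <> x4.

Definition thick : Prop :=
  forall u v, dist u v = 2 ->
    exists x1 x2 x3 x4, interval u v x1 /\ interval u v x2 /\
      interval u v x3 /\ interval u v x4 /\ induced_C4 x1 x2 x3 x4.

Definition finite_diameter (X : V -> Prop) : Prop :=
  exists n, forall x y, X x -> X y -> dist x y <= n.

Definition modular_graph : Prop :=
  is_graph /\
  forall u v w, exists x, interval u v x /\ interval v w x /\ interval w u x.

Definition is_orientation (o : V -> V -> Prop) : Prop :=
  (forall x y, o x y -> adj x y) /\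
  (forall x y, adj x y -> o x y \/ o y x) /\
  (forall x y, o x y -> ~ o y x).

Definition admissible (o : V -> V -> Prop) : Prop :=
  is_orientation o /\
  forall x1 x2 x3 x4, induced_C4 x1 x2 x3 x4 ->
    (o x1 x2 <-> o x4 x3) /\ (o x2 x3 <-> o x1 x4) /\
    (o x3 x4 <-> o x2 x1) /\ (o x4 x1 <-> o x3 x2).

Definition orientable : Prop := exists o, admissible o.

End Graphs.

Section Barycentric.
Variable V : Type.
Variable adj : V -> V -> Prop.

Definition induced_adj (X : V -> Prop) (a b : {x : V | X x}) : Prop :=
  adj (proj1_sig a) (proj1_sig b).

Definition boolean_gated (X : V -> Prop) : Prop :=
  gated adj X /\ thick (induced_adj X).

Definition BG_vertex : Type :=
  {X : V -> Prop | boolean_gated X /\ finite_diameter adj X}.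

Definition strict_subset (X Y : V -> Prop) : Prop :=
  (forall x, X x -> Y x) /\ exists y, Y y /\ ~ X y.

(* poset order: X <= Y iff Y is included in X (reverse inclusion).
   [covers B A] : B covers A in this poset, i.e. B is a strict subset of A
   with no element of B(G) strictly in between. *)
Definition covers (B A : BG_vertex) : Prop :=
  strict_subset (proj1_sig B) (proj1_sig A) /\
  ~ exists C : BG_vertex,
      strict_subset (proj1_sig B) (proj1_sig C) /\
      strict_subset (proj1_sig C) (proj1_sig A).

Definition star_adj (A B : BG_vertex) : Prop := covers A B \/ covers B A.

Definition hasse_orientation (A B : BG_vertex) : Prop := covers A B.

End Barycentric.

(* Main.v *)
(* Call a pair p, q Boolean if the lattice I(p,q) is complemented. In an swm-graph a
   Boolean pair lies in a Boolean-gated set of diameter d(p,q): take all x such that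
   (p,x) is Boolean and the lines from p towards x belong to the local subspace spanned
   by the lines from p towards q. Conversely all pairs in a Boolean-gated set are
   Boolean, so B(G), ordered by inclusion, is graded by the diameter r.
   For U, X in B(G) put f_U(X) = 2 d(U,X) + r(U) + r(X) - 2 r(pr_X U). If Y covers X
   then f_U(Y) - f_U(X) is 1 or -1 according to whether the projection of U to Y lies
   in X or not, and every X different from U has a neighbour with a smaller value;
   hence f_U is the distance from U in G*. Thus G* is bipartite, f restricts to 2d on
   singletons, and the quadrangle condition for f, checked separately for a vertex
   above, between or below its two neighbours, gives modularity. *)
Require Import Defs.
From Stdlib Require Import Arith Lia Classical ClassicalEpsilon.
From Stdlib Require Import FunctionalExtensionality PropExtensionality ProofIrrelevance.

Set Implicit Arguments.
Unset Strict Implicit.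

(** The value f_U(X) is the length of an explicit route in G*: down from U to its face isometric to
    pr_X U, then d(U,X) parallel translations, each going up to a cover and down again at cost 2,
    then up to X. This explains the factor 2 and the two codimensions. Excluding K_4^- makes maximal
    cliques behave like lines: two cliques sharing an edge agree. Excluding K_{3,3}^- makes joins in
    an interval unique, so intervals are modular lattices. Since G may be infinite, intervals are
    never enumerated: arguments climb a geodesic one step at a time, and ranks exist because members
    of B(G) have finite diameter. An interval I(p,q) is in general not gated, as it meets a line
    through p in p and at most one more point. Hence the hull is built from whole lines through p,
    not from the atoms of I(p,q). *)

(** * Distances and medians in graphs *)

Section GraphMetric.
Variable V : Type.
Variable adj : V -> V -> Prop.
Hypothesis Hg : is_graph adj.
Local Notation d := (dist adj).

Lemma adj_sym x y : adj x y -> adj y x.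
Proof. destruct Hg as (h & _). apply h. Qed.

Lemma adj_irrefl x : ~ adj x x.
Proof. destruct Hg as (_ & h & _). apply h. Qed.

Lemma walk_cat m n x y z : walk adj m x y -> walk adj n y z -> walk adj (m + n) x z.
Proof.
  induction 1 as [|m x x' y Hxx' W IH]; simpl; intros W'; auto.
  econstructor; eauto.
Qed.

Lemma walk_rev (sym : forall x y, adj x y -> adj y x) n x y : walk adj n x y -> walk adj n y x.
Proof.
  induction 1 as [|n x x' y Hxx' W IH]; [constructor|].
  replace (S n) with (n + 1) by lia.
  apply walk_cat with x'; auto.
  econstructor; [apply sym; eassumption|constructor].
Qed.

Lemma least_nat (P : nat -> Prop) : (exists n, P n) -> exists n, P n /\ forall m, P m -> n <= m.
Proof.
  intros [n Hn]. revert Hn. induction n as [n IH] using lt_wf_ind. intros Hn.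
  destruct (classic (exists m, m < n /\ P m)) as [[m [Hm Pm]]|H].
  - eauto.
  - exists n. split; auto. intros m Pm.
    destruct (le_lt_dec n m); auto. exfalso; eauto.
Qed.

Lemma dist_spec x y : is_dist adj x y (d x y).
Proof.
  unfold dist. apply epsilon_spec, least_nat. apply Hg.
Qed.

Lemma dist_walk x y : walk adj (d x y) x y.
Proof. apply dist_spec. Qed.

Lemma dist_le n x y : walk adj n x y -> d x y <= n.
Proof. apply dist_spec. Qed.

Lemma dist_eq0 x y : d x y = 0 -> x = y.
Proof.
  intros H. generalize (dist_walk x y). rewrite H. intros W. inversion W; auto.
Qed.

Lemma dist_refl x : d x x = 0.
Proof. assert (d x x <= 0) by (apply dist_le; constructor). lia. Qed.

Lemma dist_sym x y : d x y = d y x.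
Proof.
  assert (forall x y, d x y <= d y x) by (intros; apply dist_le, (walk_rev adj_sym), dist_walk).
  apply Nat.le_antisymm; auto.
Qed.

Lemma dist_tri x y z : d x z <= d x y + d y z.
Proof. apply dist_le. eapply walk_cat; apply dist_walk. Qed.

Lemma dist_adj x y : adj x y -> d x y = 1.
Proof.
  intros H. assert (d x y <= 1) by (apply dist_le; econstructor; eauto; constructor).
  assert (d x y <> 0). { intros E. apply dist_eq0 in E. subst. exact (adj_irrefl H). }
  lia.
Qed.

Lemma adj_dist x y : d x y = 1 -> adj x y.
Proof.
  intros H. generalize (dist_walk x y). rewrite H. intros W.
  inversion W as [|? ? ? ? A W']; subst. inversion W'; subst; auto.
Qed.

Lemma geodesic_step x y n : d x y = S n -> exists z, adj x z /\ d z y = n.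
Proof.
  intros H. generalize (dist_walk x y). rewrite H. intros W.
  inversion W as [|? ? z ? A W']; subst. exists z. split; auto.
  apply dist_le in W'. pose proof (dist_tri x z y). rewrite (dist_adj A) in *. lia.
Qed.

Lemma adj_dist_le z x y : adj x y ->
  d x y = 1 /\ d y x = 1 /\ d z x = d x z /\ d z y = d y z /\
  d z x <= d z y + 1 /\ d z y <= d z x + 1.
Proof.
  intros H. pose proof (dist_adj H). pose proof (dist_adj (adj_sym H)).
  pose proof (dist_tri z x y). pose proof (dist_tri z y x).
  rewrite (dist_sym z x), (dist_sym z y) in *. lia.
Qed.

Lemma dist_tri3 x y z :
  d x y = d y x /\ d x z = d z x /\ d y z = d z y /\
  d x y <= d x z + d z y /\ d x z <= d x y + d y z /\ d y z <= d y x + d x z.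
Proof.
  pose proof (dist_tri x z y). pose proof (dist_tri x y z). pose proof (dist_tri y x z).
  rewrite (dist_sym y x), (dist_sym z x), (dist_sym z y) in *. lia.
Qed.

(* Induction on [d v w]: a neighbour [x] of [v] on a geodesic to [w] may be taken
   closer to [u] than [v], unless [v] itself is a median. *)
Lemma modular_of_quadrangle :
  (forall u x y, adj x y -> d u x <> d u y) ->
  (forall u v w z, adj v z -> adj w z -> v <> w -> d u w = d u v -> d u z = S (d u v) ->
     exists x, adj x v /\ adj x w /\ d u v = S (d u x)) ->
  modular_graph adj.
Proof.
  intros Bip Q. split; auto. intros u v w. unfold interval.
  remember (d v w) as n eqn:E. revert v E.
  induction n as [|n IH]; intros v E.
  { symmetry in E. rewrite (dist_eq0 E) in *. exists w.
    rewrite !dist_refl, (dist_sym w u). lia. }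
  assert (Down : forall x, adj v x -> d x w = n -> d u v = S (d u x) ->
    exists x, d u x + d x v = d u v /\ d v x + d x w = S n /\ d w x + d x u = d w u).
  { intros x A Hx Hux. destruct (IH x) as (m & H1 & H2 & H3); auto.
    exists m. pose proof (dist_adj A). pose proof (dist_tri3 v x m).
    pose proof (dist_tri3 u m v). pose proof (dist_tri3 v m w). lia. }
  destruct (@geodesic_step v w n) as (x & A & Hx); auto.
  pose proof (adj_dist_le u A). pose proof (Bip u v x A).
  destruct (eq_nat_dec (d u v) (S (d u x))) as [|N]; [eauto|].
  destruct (IH x) as (m & H1 & H2 & H3); auto.
  destruct (d x m) as [|k] eqn:Em.
  { apply dist_eq0 in Em. subst m. exists v. rewrite dist_refl.
    pose proof (dist_tri3 u v w). pose proof (dist_tri3 w x u). lia. }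
  (* A step from [x] towards the median approaches both [u] and [w]: [y] is level with [v] as seen
     from [u], and two steps nearer to [w]. *)
  destruct (@geodesic_step x m k) as (y & Ay & Hy); auto.
  pose proof (adj_dist_le u Ay). pose proof (adj_dist_le w Ay). pose proof (adj_dist_le m Ay).
  pose proof (dist_tri3 u m y). pose proof (dist_tri3 u m x).
  pose proof (dist_tri3 w m y). pose proof (dist_tri3 w m x).
  destruct (Q u v y x) as (t & T1 & T2 & T3).
  - auto.
  - apply adj_sym; auto.
  - intros ->. pose proof (dist_tri3 y w x). lia.
  - lia.
  - lia.
  - apply (Down t); auto using adj_sym.
    + pose proof (adj_dist_le w T1). pose proof (adj_dist_le w T2). pose proof (dist_tri3 v t w). lia.
Qed.

End GraphMetric.

(** * Recognizing a distance function by its steps and descents *)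

Section Potential.
Variable W : Type.
Variable R : W -> W -> Prop.

Lemma potential_walk (f : W -> nat) r : (forall x y, R x y -> f y <= S (f x)) ->
  forall n x, walk R n r x -> f x <= n + f r.
Proof.
  intros H n x Wk. induction Wk as [|n r y x A Wk IH]; [lia|].
  specialize (H _ _ A). lia.
Qed.

Lemma potential_descend (f : W -> nat) r :
  (forall x, x <> r -> exists y, R x y /\ f x = S (f y)) -> f r = 0 ->
  forall x, walk R (f x) x r.
Proof.
  intros H Hr x. remember (f x) as n eqn:E. revert x E.
  induction n as [|n IH]; intros x E.
  - destruct (classic (x = r)) as [->|N]; [constructor|].
    destruct (H x N) as (y & _ & E'). lia.
  - destruct (H x) as (y & A & E'); [intros ->; lia|].
    apply walkS with y; auto. apply IH. lia.
Qed.

End Potential.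
(** * Local structure of swm-graphs *)

Section SwmLocal.
Variable V : Type.
Variable adj : V -> V -> Prop.
Hypothesis Hs : swm_graph adj.
Local Notation d := (dist adj).
Local Notation le p a z := (dist adj p a + dist adj a z = dist adj p z).

Lemma swm_is_graph : is_graph adj.
Proof. apply Hs. Qed.

Local Notation Hg := swm_is_graph.

Ltac base p :=
  repeat match goal with
  | H : adj ?x ?y |- _ => pose proof (adj_dist_le Hg p H); change (@id Prop (adj x y)) in H
  end;
  repeat match goal with H : @id Prop ?P |- _ => change P in H end.
Ltac tri x y z := pose proof (dist_tri3 Hg x y z).
Ltac aj := solve [assumption | apply (adj_sym Hg); assumption].
Ltac irr := match goal with H : adj ?x ?x |- _ => destruct (adj_irrefl Hg H) end.
Ltac neq p := let E := fresh in intros E; subst; base p; lia.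

Lemma tc u v w n : adj v w -> d u v = S n -> d u w = S n ->
  exists x, adj x v /\ adj x w /\ d u x = n.
Proof.
  intros A Hv Hw. destruct n as [|n].
  - exists u. repeat split; try (apply (adj_dist Hg); assumption). apply (dist_refl Hg).
  - pose proof Hs as (_ & Hwm & _). destruct (Hwm u) as [T _].
    destruct (T v w) as (x & H1 & H2 & H3); auto using dist_adj, swm_is_graph; try lia.
    exists x. repeat split; auto. lia.
Qed.

(** An edge thus lies in a single maximal clique; these cliques are the lines. *)
Lemma no_K4minus x y z w : adj x y -> adj y z -> adj x z -> adj w x -> adj w y -> w <> z ->
  adj w z.
Proof.
  intros. destruct (classic (adj w z)) as [|N]; auto. exfalso.
  pose proof Hs as (_ & _ & K & _). apply (K x y w z).
  unfold induced_K4minus. repeat split; auto; aj.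
Qed.

(** The premise of distance 2 weakens to [v <> w]: were [v], [w] adjacent, the triangle condition
    would put a point next to both at level n - 1, and [no_K4minus] would join it to [z] at level n
    + 1. *)
Lemma qc u v w z n : adj v z -> adj w z -> v <> w -> d u v = n -> d u w = n -> d u z = S n ->
  ~ adj v w /\ exists x, adj x v /\ adj x w /\ S (d u x) = n.
Proof.
  intros Av Aw N Hv Hw Hz.
  assert (n <> 0).
  { intros ->. apply N. apply (dist_eq0 Hg) in Hv, Hw. congruence. }
  assert (Na : ~ adj v w).
  { intros A. destruct n as [|n]; [lia|].
    destruct (@tc u v w n) as (x & H1 & H2 & H3); auto.
    assert (adj x z).
    { apply (@no_K4minus v w z x); try aj. neq u. }
    base u. lia. }
  split; auto.
  destruct (eq_nat_dec n 1) as [->|].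
  - exists u. split; [|split]; try (apply (adj_dist Hg); auto). rewrite (dist_refl Hg); auto.
  - pose proof Hs as (_ & Hwm & _). destruct (Hwm u) as [_ Q].
    destruct (Q v w z) as (x & H1 & H2 & H3); auto using dist_adj, swm_is_graph; try lia.
    + tri v w z. base v.
      assert (d v w <> 0) by (intros E; apply N, (dist_eq0 Hg), E).
      assert (d v w <> 1) by (intros E; apply Na, (adj_dist Hg), E). lia.
    + exists x. repeat split; auto. lia.
Qed.

(** By [qc], two distinct lower neighbours of a vertex are never adjacent, so a line not equidistant
    from [u] has one nearest point. *)
Lemma line_far u v w t n : adj v w -> adj t v -> adj t w -> d u v = n -> d u w = S n ->
  d u t = S n.
Proof.
  intros A1 A2 A3 Hv Hw.
  destruct (eq_nat_dec (d u t) n) as [E|]; [|base u; lia].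
  assert (v <> t) by (intros ->; irr).
  destruct (@qc u v t w n) as [N _]; auto. exfalso; apply N; aj.
Qed.

(* The edges [pa] and [xz] span parallel lines at distance [m]; translate [y] from one to the other. *)
Lemma line_transport p a x z y m : adj p a -> adj x z -> d p x = m -> d a z = m ->
  d p z = S m -> d a x = S m -> adj y x -> adj y z ->
  exists b, adj b p /\ adj b a /\ d b y = m.
Proof.
  intros A1 A2 H1 H2 H3 H4 A3 A4.
  assert (d p y = S m) by (apply (@line_far p x z y m); auto).
  assert (d a y = S m) by (apply (@line_far a z x y m); aj || auto).
  destruct (@tc y p a m) as (b & B1 & B2 & B3); auto.
  1,2: rewrite (dist_sym Hg); auto.
  exists b. repeat split; auto. rewrite (dist_sym Hg); auto.
Qed.

Lemma dist_two x y z : adj x y -> adj y z -> ~ adj x z -> x <> z -> d x z = 2.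
Proof.
  intros ? ? Na ?. assert (d x z <> 0) by eauto using dist_eq0, swm_is_graph.
  assert (d x z <> 1) by (intros E; apply Na, (adj_dist Hg), E).
  base x. lia.
Qed.

(** Otherwise [u], [k1], [k2] against [v], [c1], [c2] form a K_{3,3}^- with missing edge [uv]; [qc]
    from both ends excludes further edges, which makes it isometric. *)
Lemma no_K33minus u c1 c2 k1 k2 v : d u v = 3 -> adj u c1 -> adj u c2 ->
  adj k1 c1 -> adj k1 c2 -> adj k2 c1 -> adj k2 c2 -> adj k1 v -> adj k2 v -> c1 <> c2 ->
  k1 = k2.
Proof.
  intros. destruct (classic (k1 = k2)) as [|N]; auto. exfalso.
  assert (~ adj k1 k2).
  { apply (@qc u k1 k2 v 2); auto; base u; lia. }
  assert (~ adj c1 c2).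
  { apply (@qc v c1 c2 u 2); auto; try aj; base v; base u; tri u v c1; lia. }
  pose proof Hs as (_ & _ & _ & K). apply (K u k1 k2 v c1 c2).
  pose proof (@dist_two c1 k1 c2 ltac:(aj) ltac:(aj) ltac:(aj) ltac:(auto)).
  pose proof (@dist_two k1 c1 k2 ltac:(aj) ltac:(aj) ltac:(aj) ltac:(auto)).
  base u. base v. base c1. tri u v c1.
  unfold isometric_K33minus. repeat split; lia.
Qed.

Lemma line_trans p a b c : adj a p -> adj b p -> adj c p -> (a = b \/ adj a b) -> (b = c \/ adj b c) ->
  a = c \/ adj a c.
Proof.
  intros A1 A2 A3 [->|H1] [->|H2]; auto.
  destruct (classic (a = c)); auto. right.
  apply (@no_K4minus p b c a); auto; aj.
Qed.

Lemma le_trans p a b z : le p a b -> le p b z -> le p a z.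
Proof. intros. tri p a z. tri a b z. tri p a b. tri p b z. lia. Qed.

(** Uniqueness of joins below [z]: [qc] gives a point above [x], [y] and one below [c1], [c2]; the
    six points would form an isometric K_{3,3}^-. *)
Lemma join_uniq p z c1 c2 x y : c1 <> c2 -> x <> y ->
  d p c1 = d p c2 -> d p x = S (d p c1) -> d p y = S (d p c1) ->
  adj c1 x -> adj c1 y -> adj c2 x -> adj c2 y -> le p x z -> le p y z -> False.
Proof.
  intros N1 N2 E Hx Hy A1 A2 A3 A4 Lx Ly.
  assert (Lc : le p c1 z) by (base p; base z; tri p c1 z; tri p x z; lia).
  destruct (@qc z x y c1 (d x z)) as (_ & t & T1 & T2 & T3); auto; try aj.
  { apply (dist_sym Hg). } { rewrite (dist_sym Hg). lia. } { rewrite (dist_sym Hg). lia. }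
  destruct (@qc p c1 c2 x (d p c1)) as (_ & u & U1 & U2 & U3); auto.
  apply N2. apply (@no_K33minus u c1 c2 x y t); auto; try aj.
  tri u p z. tri u t z. tri z t x. base u. base p. lia.
Qed.

(** If [c] were equidistant from [x] and [z], some point of the line [xz] would be nearer to [c],
    hence below the level of [z] seen from [p]; but [x] is the only such point of that line. *)
Lemma coatom_far p x z c : adj x z -> d p z = S (d p x) -> le p c z -> ~ le p c x ->
  d c x = S (d c z).
Proof.
  intros A Hz Lc Nc. tri p c x. base c.
  destruct (eq_nat_dec (d c x) (d c z)) as [E|]; [exfalso|lia].
  assert (d c x <> 0).
  { intros E0. assert (d c z = 0) by lia.
    apply (dist_eq0 Hg) in E0. apply (dist_eq0 Hg) in H1. subst. irr. }
  destruct (@tc c x z (d c x - 1)) as (t & T1 & T2 & T3); auto; try lia.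
  assert (d p t = S (d p x)) by (apply (@line_far p x z t); auto).
  tri p c t. lia.
Qed.

(** Meeting with a coatom lowers the rank by one: climb from [c] to [z] and bring the meet back down
    with [qc] at each step. *)
Lemma meet_coatom p x z c : adj x z -> d p z = S (d p x) -> le p c z -> ~ le p c x ->
  exists c', adj c' c /\ d p c = S (d p c') /\ le p c' x.
Proof.
  intros A Hz. remember (d c z) as n eqn:En. revert c En.
  induction n as [|n IH]; intros c En Lc Nc.
  - symmetry in En. apply (dist_eq0 Hg) in En. subst c.
    exists x. repeat split; auto. rewrite (dist_refl Hg); lia.
  - destruct (@geodesic_step _ _ Hg c z n) as (e & E1 & E2); auto.
    assert (d p e = S (d p c)). { base p. tri p e z. lia. }
    destruct (IH e) as (e' & F1 & F2 & F3); auto; try lia.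
    { intros Le. apply Nc. apply (@le_trans p c e x); auto. base p. lia. }
    assert (c <> e').
    { intros ->. apply Nc; auto. }
    destruct (@qc p c e' e (d p c)) as (_ & c' & C1 & C2 & C3); auto; try lia.
    exists c'. repeat split; auto.
    apply (@le_trans p c' e' x); auto. base p. lia.
Qed.

(** [qc] seen from [e] gives a lower cover of [x] and [y] above [e]; [join_uniq] identifies it with
    [x0]. *)
Lemma meet_greatest p x y z x0 e : adj x z -> adj y z -> x <> y ->
  d p z = S (d p x) -> d p z = S (d p y) ->
  adj x0 x -> adj x0 y -> d p x = S (d p x0) -> le p e x -> le p e y -> le p e x0.
Proof.
  intros A1 A2 N H1 H2 A3 A4 H3 L1 L2.
  assert (Lz : le p x z) by (base p; lia).
  assert (Lz' : le p y z) by (base p; lia).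
  assert (d e z = S (d e x)) by (base e; base p; tri p e z; lia).
  destruct (@qc e x y z (d e x)) as (_ & x1 & B1 & B2 & B3); auto; try lia.
  assert (d p x = S (d p x1)) by (base p; tri p e x1; lia).
  destruct (classic (x0 = x1)) as [->|N1]; [lia|].
  exfalso. apply (@join_uniq p z x0 x1 x y); auto; lia.
Qed.

(** Dual to [meet_coatom]: the join with [a] is carried from [p] up to [y] by [qc] seen from [q]. *)
Lemma join_atom p q y a : le p y q -> adj p a -> le p a q -> ~ le p a y ->
  exists z, adj y z /\ d p z = S (d p y) /\ le p z q /\ le p a z.
Proof.
  intros Ly A La. remember (d p y) as n eqn:En. revert y En Ly.
  induction n as [|n IH]; intros y En Ly Na.
  - symmetry in En. pose proof (dist_eq0 Hg En). subst y. exists a.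
    rewrite (dist_refl Hg a). base p. repeat split; auto; lia.
  - destruct (@geodesic_step _ _ Hg y p n) as (y' & E1 & E2).
    { rewrite (dist_sym Hg); lia. }
    rewrite (dist_sym Hg) in E2.
    assert (Ly' : le p y' y) by (base p; lia).
    destruct (IH y') as (z' & Z1 & Z2 & Z3 & Z4); auto.
    { tri p y' q. tri y y' q. base q. lia. }
    { intros L. apply Na.  rewrite En. apply (@le_trans p a y' y); lia. }
    assert (y <> z') by (intros <-; lia).
    destruct (@qc q y z' y' (d q y)) as (_ & z & B1 & B2 & B3); auto; try aj.
    { tri p z' q. tri p y q. lia. } { tri p y' q. tri p y q. tri y y' q. base q. lia. }
    exists z. assert (d p z = S (d p y)).
    { base p. base q. tri p z q. tri p y q. lia. }
    repeat split; try aj; try lia.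
    + tri p z q. tri p y q. lia.
    + apply (@le_trans p a z' z); auto. base z. base p. lia.
Qed.

Lemma atoms_join p z e f : adj p e -> adj p f -> le p e z -> le p f z -> e <> f ->
  exists c, adj c e /\ adj c f /\ d p c = 2 /\ le p c z.
Proof.
  intros A1 A2 L1 L2 N. base p. tri p e z. tri p f z.
  destruct (@qc z e f p (d e z)) as (_ & c & C1 & C2 & C3); auto; try aj; try lia.
  assert (d p c = 2). { tri p c z. base p. lia. }
  exists c. repeat split; auto. tri p c z. lia.
Qed.

Lemma atoms_indep p z e f : adj p e -> adj p f -> le p e z -> le p f z -> ~ adj e f.
Proof.
  intros A1 A2 L1 L2 A. base p. tri p e z. tri p f z.
  destruct (@qc z e f p (d e z)) as (N & _); auto; try aj; try lia.
  intros ->. apply (adj_irrefl Hg A).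
Qed.

(** * Boolean pairs and their gated hulls *)

(* [bpair p z]: the pair is Boolean, i.e. the modular lattice I(p,z) is complemented.
   The definition asks for a maximal chain from [p] to [z] each of whose steps adds a
   new atom (an atom of I(p,z) is a neighbour of [p] in it). *)
Inductive bpair (p : V) : V -> Prop :=
| bpair_refl : bpair p p
| bpair_step x z a : bpair p x -> adj x z -> d p z = S (d p x) ->
    adj p a -> le p a z -> ~ le p a x -> bpair p z.

Lemma lower_step p z : p <> z -> exists y, adj y z /\ d p z = S (d p y).
Proof.
  intros N. destruct (d p z) as [|n] eqn:E; [destruct N; apply (dist_eq0 Hg E)|].
  destruct (@geodesic_step _ _ Hg z p n) as (y & A & Hy); [rewrite (dist_sym Hg); auto|].
  exists y. rewrite (dist_sym Hg) in Hy. split; [aj|lia].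
Qed.

(** Independence of the chain: any coatom can serve as the last step. An atom [e] below [x] but not
    below the meet [x0] of [x] and [y] is new over [y], and [y] arises from [x0] by adding one
    atom. *)
Lemma bpair_coatom p z : bpair p z -> forall y, adj y z -> d p z = S (d p y) ->
  bpair p y /\ exists a, adj p a /\ le p a z /\ ~ le p a y.
Proof.
  induction 1 as [|x z a Bx IH Axz Hxz Aa La Na]; intros y Ay Hy.
  { rewrite (dist_refl Hg) in Hy. lia. }
  destruct (classic (x = y)) as [<-|N]; [eauto|].
  assert (Lx : le p x z) by (base p; lia).
  assert (Ly : le p y z) by (base p; lia).
  destruct (@qc p x y z (d p x)) as (_ & x0 & B1 & B2 & B3); auto; try lia.
  assert (Lx0 : le p x0 x) by (base p; lia).
  destruct (IH x0) as (Bx0 & e & Ae & Le & Ne); auto.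
  assert (Nay : forall f, adj p f -> le p f x -> ~ le p f x0 -> ~ le p f y).
  { intros f Af Lf Nf Lfy. apply Nf.
    apply (@meet_greatest p x y z x0 f); auto; lia. }
  assert (Lez : le p e z) by (apply (@le_trans p e x z); auto).
  split; [|eauto 6].
  destruct (classic (le p a y)) as [Lay|Nay'].
  { apply (@bpair_step p x0 y a); auto; try lia.
    intros L. apply Na. apply (@le_trans p a x0 x); auto. }
  assert (a <> e) by (intros ->; auto).
  (* Neither [a] nor [e] is below [y]; their join has rank 2, so it meets the coatom [y] in an atom
     [f]. *)
  destruct (@atoms_join p z a e) as (c & C1 & C2 & C3 & C4); auto.
  assert (Nc : forall t, le p c t -> le p a t).
  { intros t L. apply (@le_trans p a c t); auto. base p. lia. }
  destruct (@meet_coatom p y z c) as (f & F1 & F2 & F3); auto.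
  assert (Af : adj p f) by (apply (adj_dist Hg); lia).
  assert (f <> e) by (intros ->; eapply Nay; eauto).
  (* If [f] were below [x0], the join of [f] and [e] inside I(p,x) would be [c], and [a] would be
     below [x]. *)
  assert (Nf : ~ le p f x0).
  { intros L. assert (L' : le p f x) by (apply (@le_trans p f x0 x); auto).
    destruct (@atoms_join p x f e) as (c0 & D1 & D2 & D3 & D4); auto.
    apply (@join_uniq p z f e c c0); auto; try aj; try (base p; lia).
    - intros ->. auto.
    - apply (@le_trans p c0 x z); auto. }
  apply (@bpair_step p x0 y f); auto. lia.
Qed.

Lemma bpair_le p z : bpair p z -> forall y, le p y z -> bpair p y.
Proof.
  intros B y. remember (d y z) as n eqn:En. revert z B En.
  induction n as [|n IH]; intros z B En L.
  - symmetry in En. rewrite (dist_eq0 Hg En). auto.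
  - destruct (@lower_step y z) as (x & A & Hx).
    { intros ->. rewrite (dist_refl Hg) in En. lia. }
    assert (d p z = S (d p x)) by (tri p y x; base p; lia).
    apply (IH x); try lia. destruct (@bpair_coatom p z B x); auto.
Qed.

(** [coatom_far] makes the lines [pa] and [xz] parallel, so the third point [y] can be carried over
    to the line [pa]. *)
Lemma line_atom p x y z a : adj x y -> adj x z -> adj y z ->
  d p y = S (d p x) -> d p z = S (d p x) -> adj p a -> le p a z -> ~ le p a x ->
  exists b, adj p b /\ le p b y /\ ~ le p b x /\ adj b a.
Proof.
  intros A1 A2 A3 Hy Hz Aa La Na.
  assert (d a x = S (d a z)) by (apply (@coatom_far p x z a); auto).
  base p.
  destruct (@line_transport p a x z y (d p x)) as (b & B1 & B2 & B3); auto; try aj; try lia.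
  exists b. split; [aj|]. base p. split; [lia|]. split; [|auto].
  assert (d x b = S (d x p)).
  { apply (@line_far x p a b); auto; tri x p a; base x; lia. }
  base x. tri x p b. lia.
Qed.

Lemma bpair_line p x y z : adj x y -> adj x z -> adj y z ->
  d p y = S (d p x) -> d p z = S (d p x) -> bpair p y -> bpair p z.
Proof.
  intros A1 A2 A3 Hy Hz B.
  destruct (@bpair_coatom p y B x) as (Bx & a & Aa & La & Na); auto.
  destruct (@line_atom p x z y a) as (b & B1 & B2 & B3 & B4); auto; try aj.
  apply (@bpair_step p x z b); auto.
Qed.

Lemma bpair_new_atom p x y z : adj x z -> adj y z -> x <> y -> d p z = S (d p x) ->
  d p y = d p x -> bpair p y -> exists f, adj p f /\ le p f y /\ ~ le p f x.
Proof.
  intros A1 A2 N H1 H2 B.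
  destruct (@qc p x y z (d p x)) as (_ & x0 & B1 & B2 & B3); auto; try lia.
  destruct (@bpair_coatom p y B x0) as (_ & f & F1 & F2 & F3); auto; try lia.
  exists f. repeat split; auto. intros L. apply F3.
  apply (@meet_greatest p x y z x0 f); auto; lia.
Qed.

Lemma bpair_top p x y z : adj x z -> adj y z -> x <> y -> d p z = S (d p x) ->
  d p y = d p x -> bpair p x -> bpair p y -> bpair p z.
Proof.
  intros A1 A2 N H1 H2 Bx By.
  destruct (@bpair_new_atom p x y z) as (f & F1 & F2 & F3); auto.
  apply (@bpair_step p x z f); auto.
  apply (@le_trans p f y z); auto. base p. lia.
Qed.

Definition common_nbr_closed (X : V -> Prop) : Prop :=
  forall x y z, X x -> X y -> x <> y -> adj x z -> adj y z -> X z.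

Lemma triangle_gate p x z : adj x z -> d p x = d p z ->
  exists g, adj g x /\ adj g z /\ d p x = S (d p g).
Proof.
  intros A E. destruct (d p x) as [|n] eqn:Ex.
  - symmetry in E. apply (dist_eq0 Hg) in E, Ex. subst. irr.
  - destruct (@tc p x z n) as (g & G1 & G2 & G3); auto. exists g. auto.
Qed.

(** Splits closure proofs by the level of [z] seen from [p]: below a neighbour, level with it (then
    both share a line with a lower [g]), or above both. *)
Lemma level_cases p (X : V -> Prop) x y z :
  X x -> X y -> x <> y -> adj x z -> adj y z ->
  (forall x, X x -> adj x z -> d p x = S (d p z) -> X z) ->
  (forall g x, X x -> adj x z -> adj g x -> adj g z -> d p x = S (d p g) -> d p z = S (d p g) -> X z) ->
  (forall x y, X x -> X y -> x <> y -> adj x z -> adj y z -> d p z = S (d p x) -> d p y = d p x -> X z) ->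
  X z.
Proof.
  intros Xx Xy N A1 A2 Cd Cl Cu.
  assert (P : forall x, X x -> adj x z -> X z \/ d p z = S (d p x)).
  { intros t Xt At. base p.
    destruct (eq_nat_dec (d p t) (S (d p z))); [left; apply (Cd t); auto|].
    destruct (eq_nat_dec (d p t) (d p z)) as [E|]; [left|right; lia].
    destruct (@triangle_gate p t z) as (g & G1 & G2 & G3); auto.
    apply (Cl g t); auto. lia. }
  destruct (P x) as [|Hx]; auto. destruct (P y) as [|Hy]; auto.
  apply (Cu x y); auto. lia.
Qed.

Lemma bpair_closed p : common_nbr_closed (bpair p).
Proof.
  intros x y z Bx By N A1 A2. apply (@level_cases p (bpair p) x y z); auto; clear - Hs.
  - intros x Bx A H. apply (@bpair_le p x); auto. base p. lia.
  - intros g x Bx A1 A2 A3 H1 H2. apply (@bpair_line p g x z); auto.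
  - intros x y Bx By N A1 A2 H1 H2. apply (@bpair_top p x y z); auto.
Qed.

(* A local subspace at [p]: a union of lines through [p] closed under the
   planes spanned by any two of its lines. *)
Definition subspace_at (p : V) (S : V -> Prop) : Prop :=
  (forall e a, S e -> adj p a -> adj e a -> S a) /\
  (forall e f c a, S e -> S f -> e <> f -> adj p e -> adj p f -> adj p a -> d p c = 2 ->
     adj c e -> adj c f -> adj c a -> S a).

Definition span (p : V) (S : V -> Prop) (x : V) : Prop :=
  bpair p x /\ forall a, adj p a -> le p a x -> S a.

Lemma span_le p S x y : span p S x -> le p y x -> span p S y.
Proof.
  intros [B A] L. split; [apply (@bpair_le p x); auto|].
  intros a Aa La. apply A; auto. apply (@le_trans p a y x); auto.
Qed.

(** The main case has [z] above [x] and [y]. For an atom [a] of [z] and an atom [f] below [y] but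
    not [x], the join of [a] and [f] meets [x] in an atom [e], so [a] lies in the plane of [e] and
    [f]. *)
Lemma span_closed p S : subspace_at p S -> common_nbr_closed (span p S).
Proof.
  intros [S1 S2] x y z Bx By N A1 A2.
  apply (@level_cases p (span p S) x y z); auto; clear - Hs S1 S2.
  - intros x Bx A H. apply (@span_le p S x); auto. base p. lia.
  - intros g x [Bx Sx] A1 A2 A3 H1 H2. split; [apply (@bpair_line p g x z); auto|].
    intros a Aa La. destruct (classic (le p a g)) as [L|L].
    + apply Sx; auto. apply (@le_trans p a g x); auto. base p; lia.
    + destruct (@line_atom p g x z a) as (b & B1 & B2 & B3 & B4); auto.
      apply (S1 b); auto.
  - intros x y [Bx Sx] [By Sy] N A1 A2 H1 H2. split; [apply (@bpair_top p x y z); auto|].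
    intros a Aa La.
    destruct (@bpair_new_atom p x y z) as (f & F1 & F2 & F3); auto.
    destruct (classic (a = f)) as [->|Nf]; [auto|].
    assert (le p f z) by (apply (@le_trans p f y z); auto; base p; lia).
    destruct (@atoms_join p z a f) as (c & C1 & C2 & C3 & C4); auto.
    destruct (@meet_coatom p x z c) as (e & E1 & E2 & E3); auto.
    { intros L. apply F3. apply (@le_trans p f c x); auto. base p. lia. }
    assert (adj p e) by (apply (adj_dist Hg); lia).
    apply (S2 e f c a); auto; try aj. intros ->; auto.
Qed.

(* The atoms of [I(p,q)] span the lines through [p] that come closer to [q]. *)
Definition toward (p q e : V) : Prop :=
  adj p e /\ exists e', adj p e' /\ le p e' q /\ (e = e' \/ adj e e').

Lemma plane_move p e f c e' : adj p e -> adj p f -> adj c e -> adj c f -> e <> f ->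
  d p c = 2 -> adj p e' -> (e = e' \/ adj e e') ->
  exists c1, adj c1 e' /\ adj c1 f /\ d p c1 = 2 /\ e' <> f /\
    forall a, adj p a -> adj c a -> exists a1, adj p a1 /\ adj c1 a1 /\ (a = a1 \/ adj a a1).
Proof.
  intros A1 A2 A3 A4 N Hc A5 [<-|A6]; [exists c; repeat split; eauto|].
  destruct (@qc p e f c 1) as (Nef & _); auto; try aj; try (base p; lia).
  assert (d e f = 2) by (apply (@dist_two e c f); auto; aj).
  destruct (@line_transport f c p e e' 1) as (b & B1 & B2 & B3); auto; try aj;
    try (base p; base e; tri e f c; tri p f c; lia).
  assert (Hb : d p b = 2) by (apply (@line_far p f c b 1); base p; auto; try aj; lia).
  exists b. split; [apply (adj_dist Hg); auto|]. repeat split; auto.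
  { intros ->. auto. }
  intros a Aa Ca. destruct (classic (a = f)) as [->|Nf]; [exists f; auto|].
  destruct (@qc p a f c 1) as (Naf & _); auto; try aj; try (base p; lia).
  assert (d a f = 2) by (apply (@dist_two a c f); auto; aj).
  destruct (@line_transport p a f c b 1) as (a1 & D1 & D2 & D3); auto; try aj;
    try (base p; base a; lia).
  exists a1. split; [aj|]. split; [|right; aj].
  apply (adj_sym Hg), (adj_dist Hg); auto.
Qed.

(** Two points over the same two lines represent the same plane: [a] at distance 3 from [c'] would
    complete an isometric K_{3,3}^-, and at distance 2 the triangle condition finds [a'] on the line
    [pa]. *)
Lemma plane_exchange p e f c c' a : e <> f -> adj p e -> adj p f -> adj p a ->
  d p c = 2 -> d p c' = 2 -> adj c e -> adj c f -> adj c' e -> adj c' f -> adj c a ->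
  exists a', adj p a' /\ adj c' a' /\ (a = a' \/ adj a a').
Proof.
  intros N A1 A2 A3 Hc Hc' A4 A5 A6 A7 A8.
  assert (d a c' <= 3) by (base p; tri a p c'; lia).
  assert (d a c' <> 0) by (intros E; apply (dist_eq0 Hg) in E; subst; base p; lia).
  destruct (eq_nat_dec (d a c') 1) as [E|].
  { exists a. repeat split; auto. apply (adj_sym Hg), (adj_dist Hg), E. }
  destruct (eq_nat_dec (d a c') 2) as [E|].
  { destruct (@tc c' p a 1) as (b & B1 & B2 & B3); auto.
    1,2: rewrite (dist_sym Hg); auto.
    exists b. repeat split; try aj. apply (adj_dist Hg); auto. right; aj. }
  exfalso. apply N.
  apply (@no_K33minus a p c e f c'); auto; try aj; try lia.
  intros <-. rewrite (dist_refl Hg) in *. lia.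
Qed.

Lemma toward_atoms p q e f c : toward p q e -> toward p q f -> e <> f -> adj c e -> adj c f ->
  d p c = 2 -> exists e' f' c', adj p e' /\ adj p f' /\ le p e' q /\ le p f' q /\ e' <> f' /\
    adj c' e' /\ adj c' f' /\ d p c' = 2 /\
    forall a, adj p a -> adj c a -> exists a', adj p a' /\ adj c' a' /\ (a = a' \/ adj a a').
Proof.
  intros (Ae & e' & Ae' & Le & Re) (Af & f' & Af' & Lf & Rf) N A1 A2 Hc.
  destruct (@plane_move p e f c e') as (c1 & B1 & B2 & B3 & B4 & B5); auto.
  destruct (@plane_move p f e' c1 f') as (c2 & C1 & C2 & C3 & C4 & C5); auto.
  exists e', f', c2. repeat split; auto.
  intros a Aa Ca. destruct (B5 a) as (a1 & D1 & D2 & D3); auto.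
  destruct (C5 a1) as (a2 & E1 & E2 & E3); auto.
  exists a2. repeat split; auto. apply (@line_trans p a a1 a2); auto; aj.
Qed.

Lemma toward_square p q e f : toward p q e -> toward p q f -> e <> f -> ~ adj e f ->
  exists c, adj c e /\ adj c f /\ d p c = 2.
Proof.
  intros (Ae & e' & Ae' & Le & Re) (Af & f' & Af' & Lf & Rf) N Na.
  assert (N' : e' <> f').
  { intros <-. destruct (@line_trans p e e' f) as [|]; auto; try aj.
    destruct Rf as [|]; [auto|right; aj]. }
  destruct (@atoms_join p q e' f') as (c & C1 & C2 & C3 & C4); auto.
  destruct (@plane_move p e' f' c e) as (c1 & B1 & B2 & B3 & B4 & _); auto.
  { destruct Re; [auto|right; aj]. }
  destruct (@plane_move p f' e c1 f) as (c2 & D1 & D2 & D3 & _); auto.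
  { destruct Rf; [auto|right; aj]. }
  eauto.
Qed.

(** A plane spanned by two such lines is moved onto genuine atoms of I(p,q), then onto their join in
    I(p,q); its lines then have points in I(p,q). *)
Lemma toward_subspace p q : subspace_at p (toward p q).
Proof.
  split.
  - intros e a (Ae & e' & Ae' & Le & Re) Aa A. split; auto. exists e'. repeat split; auto.
    apply (@line_trans p a e e'); auto; try aj. right; aj.
  - intros e f c a Te Tf N Ae Af Aa Hc C1 C2 C3. split; auto.
    destruct (@toward_atoms p q e f c) as (e' & f' & c2 & D1 & D2 & D3 & D4 & D5 & D6 & D7 & D8 & D9); auto.
    destruct (D9 a) as (a2 & E1 & E2 & E3); auto.
    destruct (@atoms_join p q e' f') as (c' & C1' & C2' & C3' & C4'); auto.
    destruct (@plane_exchange p e' f' c2 c' a2) as (a3 & F1 & F2 & F3); auto.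
    exists a3. repeat split; auto.
    + tri p a3 q. base p. base q. tri q c' a3. tri p c' q. lia.
    + apply (@line_trans p a a2 a3); auto; aj.
Qed.

(** * Gatedness from a local condition *)

Lemma walk_mono (R R' : V -> V -> Prop) n x y : (forall x y, R x y -> R' x y) ->
  walk R n x y -> walk R' n x y.
Proof. induction 2; econstructor; eauto. Qed.

Lemma walk_0 (R : V -> V -> Prop) x y : walk R 0 x y -> x = y.
Proof. inversion 1; auto. Qed.

Lemma walk_S (R : V -> V -> Prop) n x y : walk R (S n) x y -> exists z, R x z /\ walk R n z y.
Proof. inversion 1; eauto. Qed.

(** With [a] in [X] nearest to [u], each [y] in [X] has a walk inside [X] to [a] of length
    [d u y - d u a]. This property passes to neighbours in [X], hence to all of [X] by
    connectedness. *)
Lemma closed_connected_gated (X : V -> Prop) : (exists x, X x) ->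
  (forall x y, X x -> X y -> exists n, walk (fun a b => adj a b /\ X a /\ X b) n x y) ->
  common_nbr_closed X -> gated adj X.
Proof.
  intros [x0 X0] Conn Cl u.
  destruct (@least_nat (fun k => exists a, X a /\ d u a = k)) as (k & (a & Xa & Ha) & Min).
  { exists (d u x0), x0; auto. }
  assert (Hmin : forall y, X y -> k <= d u y) by (intros; apply Min; eauto).
  pose (R := fun a b => adj a b /\ X a /\ X b).
  assert (Rd : forall n x, walk R n x a -> d x a <= n).
  { intros n x W. apply (dist_le Hg). apply walk_mono with R; auto. intros ? ? []; auto. }
  assert (WX : forall n x, walk R n x a -> X x).
  { intros n x W. inversion W as [|? ? ? ? [? []] ?]; subst; auto. }
  (* [C] treats neighbours no further from [u]: a lower one by [qc] with the next vertex of the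
     walk, a level one through the lower point [g] of a triangle. *)
  assert (C : forall j y', walk R j y' a -> d u y' = k + j -> forall y, X y -> adj y y' ->
     (d u y + 1 = k + j -> exists i, j = S i /\ walk R i y a) /\ (d u y = k + j -> walk R j y a)).
  { induction j as [|j IH]; intros y' W Hy' y Xy A.
    - pose proof (walk_0 W). subst y'. assert (F : d u y + 1 = k + 0 -> False).
      { specialize (Hmin _ Xy). lia. }
      split; [intros E; destruct (F E)|]. intros E. exfalso.
      destruct (@triangle_gate u y a) as (g & G1 & G2 & G3); auto; try lia.
      assert (X g) by (apply (Cl y a); auto; try aj; intros ->; irr).
      specialize (Hmin g ltac:(auto)). lia.
    - assert (F : forall y, X y -> adj y y' -> d u y + 1 = k + S j ->
        exists i, S j = S i /\ walk R i y a).
      { clear y Xy A. intros y Xy A E.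
        destruct (walk_S W) as (y2 & (A2 & _ & X2) & W2).
        assert (d u y2 = k + j).
        { specialize (Rd _ _ W2). tri u y2 a. base u. lia. }
        exists j. split; auto. destruct (classic (y = y2)) as [->|N]; auto.
        destruct (@qc u y y2 y' (k + j)) as (_ & t & T1 & T2 & T3); auto; try aj; try lia.
        assert (Xt : X t) by (apply (Cl y y2); auto; aj).
        destruct (IH y2 W2 ltac:(lia) t) as [H' _]; auto.
        destruct H' as (i & -> & Wi); [lia|].
        apply walkS with t; auto. repeat split; auto; aj. }
      split; auto. intros E.
      destruct (@triangle_gate u y y') as (g & G1 & G2 & G3); auto; try lia.
      assert (Xy' : X y') by eauto.
      assert (X g) by (apply (Cl y y'); auto; try aj; intros ->; irr).
      destruct (F g) as (i & Ei & Wi); auto; try lia.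
      rewrite Ei. apply walkS with g; auto. repeat split; auto; aj. }
  exists a. split; auto. intros y Xy. unfold interval. rewrite Ha.
  assert (Q : exists j, walk R j y a /\ d u y = k + j).
  { destruct (Conn y a) as [n W]; auto. clear Xy. revert y W.
    induction n as [|n IH]; intros y W.
    - rewrite (walk_0 W). exists 0. split; [constructor|lia].
    - destruct (walk_S W) as (y1 & (A1 & X1 & X1') & W1).
      destruct (IH y1) as (j & W2 & E); auto.
      assert (D : d u y = k + S j \/ d u y = k + j \/ d u y + 1 = k + j) by (base u; lia).
      destruct (C j y1 W2 E y) as [C1 C2]; auto.
      destruct D as [D|[D|D]].
      + exists (S j). split; auto. apply walkS with y1; auto. repeat split; auto.
      + exists j. auto.
      + destruct C1 as (i & -> & Wi); auto. exists i. split; auto. lia. }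
  destruct Q as (j & W & E). specialize (Rd _ _ W). tri u y a. lia.
Qed.

Lemma starlike_closed_gated (X : V -> Prop) p : X p ->
  (forall x y, X x -> le p y x -> X y) -> common_nbr_closed X -> gated adj X.
Proof.
  intros Xp St Cl. apply closed_connected_gated; eauto.
  assert (W : forall x, X x -> exists n, walk (fun a b => adj a b /\ X a /\ X b) n x p).
  { intros x. remember (d p x) as n eqn:E. revert x E.
    induction n as [|n IH]; intros x E Xx.
    - symmetry in E. rewrite (dist_eq0 Hg E) in *. exists 0. constructor.
    - destruct (@lower_step p x) as (y & A & Hy).
      { intros ->. rewrite (dist_refl Hg) in E. lia. }
      assert (X y) by (apply (St x); auto; base p; lia).
      destruct (IH y) as [m Wm]; auto; try lia.
      exists (S m). apply walkS with y; auto. repeat split; auto; aj. }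
  intros x y Xx Xy. destruct (W x Xx) as [m Wx]. destruct (W y Xy) as [n Wy].
  exists (m + n). apply walk_cat with p; auto. apply walk_rev; auto.
  intros a b (? & ? & ?); repeat split; auto; aj.
Qed.

(** * Changing the base point of Boolean pairs *)

(** I(q,x) is an upper interval of I(p,x); joining with [q] turns each new atom [a] into a new atom
    [c] over [q]. *)
Lemma bpair_atom p x q : bpair p x -> adj p q -> le p q x -> bpair q x.
Proof.
  intros B A L. remember (d p x) as n eqn:E. revert x B L E.
  induction n as [|n IH]; intros x B L E; [base p; lia|].
  destruct (classic (q = x)) as [<-|N]; [constructor|].
  destruct (@lower_step q x) as (y & A1 & H1); auto.
  assert (Hy : d p x = S (d p y)) by (base p; tri p q y; lia).
  assert (Lq : le p q y) by (base p; lia).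
  destruct (@bpair_coatom p x B y) as (By & a & Aa & La & Na); auto.
  assert (L' : le p q x) by lia.
  assert (Naq : a <> q) by (intros ->; auto).
  destruct (@atoms_join p x a q) as (c & C1 & C2 & C3 & C4); auto.
  assert (le q c x) by (base p; lia).
  apply (@bpair_step q y x c); auto; try aj; try lia.
  - apply IH; auto; lia.
  - intros Lc. apply Na. apply (@le_trans p a c y); base p; tri p c y; lia.
Qed.

(** In the last step [a] complements [y]; read from [x], the vertex [y] is an atom that is new over
    [a]. *)
Lemma bpair_sym p x : bpair p x -> bpair x p.
Proof.
  remember (d p x) as n eqn:E. revert p x E.
  induction n as [n IH] using lt_wf_ind. intros p x E B.
  inversion B as [|y z a By A Hy Aa La Na]; subst; [constructor|].
  assert (Ba : bpair a x) by (apply (@bpair_atom p x a); auto).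
  assert (bpair x a) by (apply (IH (d a x)); auto; base p; lia).
  apply (@bpair_step x a p y); auto; try aj.
  - base p. tri x p a. tri x p y. lia.
  - base p. tri x p y. base x. lia.
  - intros L. apply Na. base p. base a. base x. tri a x y. tri p x y. tri p x a. lia.
Qed.

(** Here [q] leads away from [x] and the interval grows; the squares at [p] translate each new atom
    [a] to an atom [c] over [q]. *)
Lemma bpair_away (X : V -> Prop) p q :
  (forall x y, X x -> le p y x -> X y) ->
  (forall e f, X e -> X f -> adj p e -> adj p f -> e <> f -> ~ adj e f ->
     exists c, adj c e /\ adj c f /\ c <> p) ->
  X q -> adj p q -> forall x, bpair p x -> X x -> d q x = S (d p x) -> bpair q x.
Proof.
  intros St Sq Xq A x B. induction B as [|y x a By IH Ayx Hx Aa La Na]; intros Xx Hqx.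
  { assert (bpair q q) by apply bpair_refl.
    apply (@bpair_step q q p p); try aj; rewrite !(dist_refl Hg) in *; base q; lia. }
  assert (Hqy : d q y = S (d p y)) by (base q; tri q p y; lia).
  assert (Xy : X y) by (apply (St x); auto; base p; lia).
  assert (N : a <> q) by (intros ->; base p; lia).
  assert (Naq : ~ adj a q) by (intros Q; base p; base x; tri q a x; lia).
  destruct (@Sq a q) as (c & C1 & C2 & C3); auto.
  { apply (St x); auto. }
  assert (Hcx : d c x = d p x) by (base x; base p; lia).
  apply (@bpair_step q y x c); auto; try aj; try lia.
  { base q. lia. }
  intros Lc.
  assert (Hay : d a y = S (d a x)) by (apply (@coatom_far p y x a); auto).
  destruct (@qc y p c a (d p y)) as (_ & e & E1 & E2 & E3); auto; try aj.
  { apply (dist_sym Hg). } { base q. rewrite (dist_sym Hg). lia. }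
  { base p. rewrite (dist_sym Hg). lia. }
  assert (Le : le p e y) by (base p; base y; lia).
  assert (a <> e) by (intros ->; auto).
  destruct (@atoms_join p x a e) as (k & K1 & K2 & K3 & K4); auto; try aj.
  { apply (@le_trans p e y x); auto. base p. lia. }
  (* With [c] below [y], the points [q], [a], [e] against [k], [p], [c] would form an isometric
     K_{3,3}^-. *)
  match goal with H : a <> e |- _ => apply H end. apply (@no_K33minus q p c a e k); auto; try aj.
  base p. tri q k x. base q. tri p q k. lia.
Qed.

(** Beyond the neighbours of [p], each [x] has two coatoms, one above the new atom [a] and one not,
    and [bpair_closed] based at [y] applies. *)
Lemma star_all_bpair (X : V -> Prop) p : X p ->
  (forall x y, X x -> le p y x -> X y) ->
  (forall x, X x -> bpair p x) ->
  (forall e f, X e -> X f -> adj p e -> adj p f -> e <> f -> ~ adj e f ->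
     exists c, adj c e /\ adj c f /\ c <> p) ->
  forall y x, X y -> X x -> bpair y x.
Proof.
  intros Xp St B Sq y x Xy. remember (d p x) as n eqn:E. revert x E.
  induction n as [n IH] using lt_wf_ind. intros x E Xx.
  assert (Byp : bpair y p) by (apply bpair_sym; auto).
  destruct (le_lt_dec n 1) as [L|L].
  - destruct n as [|n].
    { symmetry in E. rewrite <- (dist_eq0 Hg E). auto. }
    assert (A : adj p x) by (apply (adj_dist Hg); lia).
    assert (D : d x y = S (d p y) \/ d p y = S (d x y) \/ d y p = d y x) by (base y; lia).
    destruct D as [D|[D|D]].
    + apply bpair_sym. apply (@bpair_away X p x); auto.
    + apply (@bpair_le y p); auto. base y. lia.
    + destruct (@triangle_gate y p x) as (g & G1 & G2 & G3); auto.
      apply (@bpair_line y g p x); auto; lia.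
  - pose proof (B x Xx) as Bx. inversion Bx as [|u z a Bu Au Hu Aa La Na]; subst.
    { rewrite (dist_refl Hg) in L. lia. }
    destruct (@lower_step a x) as (v & Av & Hv).
    { intros ->. base p. lia. }
    assert (Hv' : d p x = S (d p v)) by (base p; base x; tri p v x; tri p a v; lia).
    assert (bpair y u) by (apply (IH (d p u)); auto; try lia; apply (St x); auto; base p; lia).
    assert (bpair y v) by (apply (IH (d p v)); auto; try lia; apply (St x); auto; base p; lia).
    apply (@bpair_closed y u v x); auto.
    intros ->. apply Na. base p. lia.
Qed.

(* Transfers [x] to an element of I(p,q) of the same rank by replacing its atoms with
   atoms on the same lines; hence no element of the span is further from [p] than [q]. *)
Lemma span_rank p q x : bpair p x -> (forall a, adj p a -> le p a x -> toward p q a) ->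
  exists x', d p x' = d p x /\ le p x' q /\ forall e, adj p e -> le p e x' -> toward p x e.
Proof.
  induction 1 as [|y x a By IH Ayx Hx Aa La Na]; intros T.
  { exists p. rewrite (dist_refl Hg). repeat split; auto. base p. lia. }
  assert (Lyx : le p y x) by (base p; lia).
  destruct IH as (y' & Hy' & Ly' & Ty').
  { intros e Ae Le. apply T; auto. apply (@le_trans p e y x); auto. }
  destruct (T a) as (_ & a' & Aa' & La' & Ra); auto.
  assert (Na' : ~ le p a' y').
  { intros L. destruct (Ty' a') as (_ & b & Ab & Lb & Rb); auto.
    destruct (@line_trans p a a' b) as [->|A]; auto; try aj.
    apply (@atoms_indep p x a b); auto. apply (@le_trans p b y x); auto. }
  destruct (@join_atom p q y' a') as (x' & A1 & H1 & L1 & L2); auto.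
  exists x'. split; [lia|]. split; auto. intros e Ae Le.
  assert (Ty : forall e, toward p y e -> toward p x e).
  { intros f (F1 & f' & F2 & F3 & F4). split; auto. exists f'. repeat split; auto.
    apply (@le_trans p f' y x); auto. }
  assert (Tx : toward p x a').
  { split; auto. exists a. repeat split; auto. destruct Ra; [auto|right; aj]. }
  destruct (classic (le p e y')) as [|Ne]; auto.
  destruct (classic (e = a')) as [->|Nea]; auto.
  destruct (@atoms_join p x' e a') as (c & C1 & C2 & C3 & C4); auto.
  destruct (@meet_coatom p y' x' c) as (f & F1 & F2 & F3); auto.
  { intros L. apply Ne. apply (@le_trans p e c y'); auto. base p. lia. }
  assert (Af : adj p f) by (apply (adj_dist Hg); lia).
  destruct (@toward_subspace p x) as [_ S2].
  apply (S2 f a' c e); auto; try aj. intros ->; auto.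
Qed.

(** If [d q x = k + 1] and [d p x = k], then [p] is a coatom of I(x,q), and an atom complementary to
    it is at distance k + 1 from [p]. *)
Lemma eccentricity_nbr (X : V -> Prop) k p q :
  (forall x y z, X x -> X y -> le x z y -> X z) ->
  (forall x y, X x -> X y -> bpair x y) -> X p -> X q -> adj p q ->
  (forall x, X x -> d p x <= k) -> forall x, X x -> d q x <= k.
Proof.
  intros Cv B Xp Xq A E x Xx. destruct (le_lt_dec (d q x) k) as [|L]; auto. exfalso.
  assert (d q x = S k /\ d p x = k) as [H1 H2].
  { specialize (E x Xx). base x. tri q p x. lia. }
  destruct (@bpair_coatom x q (B x q Xx Xq) p) as (_ & b & Ab & Lb & Nb); auto.
  { tri x q p. tri x q x. lia. }
  assert (d b p = S (d b q)).
  { apply (@coatom_far x p q b); auto. tri x q p. tri x q x. lia. }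
  assert (Xb : X b) by (apply (Cv x q); auto).
  specialize (E b Xb). base x. tri x q p. tri p b q. lia.
Qed.

Lemma eccentricity_const (X : V -> Prop) k p q :
  (forall x y z, X x -> X y -> le x z y -> X z) ->
  (forall x y, X x -> X y -> bpair x y) -> X p -> X q ->
  (forall x, X x -> d p x <= k) -> forall x, X x -> d q x <= k.
Proof.
  intros Cv B Xp Xq E. remember (d p q) as n eqn:En. revert q Xq En.
  induction n as [|n IH]; intros q Xq En.
  - symmetry in En. rewrite <- (dist_eq0 Hg En). auto.
  - destruct (@lower_step p q) as (y & A & Hy).
    { intros ->. rewrite (dist_refl Hg) in En. lia. }
    assert (X y) by (apply (Cv p q); auto; base p; lia).
    apply (@eccentricity_nbr X k y q); auto. apply IH; auto. lia.
Qed.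

Lemma gated_convex (X : V -> Prop) : gated adj X -> forall x y z, X x -> X y -> le x z y -> X z.
Proof.
  intros G x y z Xx Xy L. destruct (G z) as (g & Xg & Hgt).
  pose proof (Hgt x Xx) as H1. pose proof (Hgt y Xy) as H2. unfold interval in *.
  assert (E : d z g = 0) by (tri x g y; tri z g x; tri z g y; tri x z y; lia).
  rewrite (dist_eq0 Hg E). auto.
Qed.

(* The gated hull of a Boolean pair. Gatedness is a local property in weakly modular
   graphs, so it suffices that the span is closed under common neighbours. *)
Lemma bpair_hull p q : bpair p q -> exists X, gated adj X /\ X p /\ X q /\
  forall x y, X x -> X y -> bpair x y /\ d x y <= d p q.
Proof.
  intros B. pose (X := span p (toward p q)).
  assert (Xp : X p).
  { split; [constructor|]. intros a A L. rewrite (dist_refl Hg) in L. base p. lia. }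
  assert (Xq : X q).
  { split; auto. intros a A L. split; auto. exists a; auto. }
  assert (St : forall x y, X x -> le p y x -> X y) by (intros; eapply span_le; eauto).
  assert (G : gated adj X).
  { apply (@starlike_closed_gated X p); auto. apply span_closed, toward_subspace. }
  assert (Bx : forall x y, X x -> X y -> bpair x y).
  { apply (@star_all_bpair X p); auto; [intros x []; auto|].
    intros e f Xe Xf Ae Af N Na.
    assert (Te : forall e, X e -> adj p e -> toward p q e).
    { intros t [_ Ht] At. apply Ht; auto. rewrite (dist_refl Hg). lia. }
    destruct (@toward_square p q e f) as (c & C1 & C2 & C3); auto.
    exists c. repeat split; auto. intros ->. rewrite (dist_refl Hg) in C3. lia. }
  exists X. split; [auto|]. split; [auto|]. split; [auto|]. intros x y Xx Xy. split; auto.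
  apply (@eccentricity_const X (d p q) p x); auto; [apply gated_convex; auto|].
  intros z [Bz Tz]. destruct (@span_rank p q z) as (z' & H1 & H2 & _); auto. lia.
Qed.

(** After a first step from [p] to [b], the pair [b], [x] is Boolean with a new atom [c]. Thickness
    gives another midpoint [a] of [p] and [c]; were [a] below [y], unique joins would put [c] below
    [y]. *)
Lemma thick_all_bpair (X : V -> Prop) :
  (forall x y z, X x -> X y -> le x z y -> X z) ->
  (forall u v, X u -> X v -> d u v = 2 ->
     exists a b, a <> b /\ adj u a /\ adj a v /\ adj u b /\ adj b v) ->
  forall p x, X p -> X x -> bpair p x.
Proof.
  intros Cv Th p x. remember (d p x) as n eqn:E. revert p x E.
  induction n as [|n IH]; intros p x E Xp Xx.
  { symmetry in E. rewrite (dist_eq0 Hg E). constructor. }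
  symmetry in E. destruct (@geodesic_step _ _ Hg p x n) as (b & Ab & Hb); auto.
  assert (Lb : le p b x) by (base p; lia).
  assert (Xb : X b) by (apply (Cv p x); auto).
  assert (Bb : bpair b x) by (apply IH; auto).
  inversion Bb as [|y z c By Ay Hy Ac Lc Nc]; subst.
  { apply (@bpair_step p p x x); auto; [apply bpair_refl| |].
    - rewrite E, !(dist_refl Hg). base p. tri x p x. lia.
    - rewrite !(dist_refl Hg). lia. }
  assert (Hpy : d p x = S (d p y)) by (base p; tri p b y; lia).
  assert (Xy : X y) by (apply (Cv p x); auto; base p; lia).
  assert (Lby : le p b y) by (base p; lia).
  assert (Bpy : bpair p y) by (apply IH; auto; lia).
  assert (Hpc : d p c = 2) by (base p; tri p c x; base b; lia).
  assert (Lpc : le p c x) by (base p; lia).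
  assert (Xc : X c) by (apply (Cv p x); auto).
  assert (exists a, a <> b /\ adj p a /\ adj a c) as (a & Nab & Aa & Aac).
  { destruct (Th p c) as (a1 & a2 & N & A1 & A2 & A3 & A4); auto.
    destruct (classic (a1 = b)) as [->|]; [exists a2|exists a1]; auto. }
  assert (La : le p a x) by (base p; tri a c x; tri p a x; lia).
  apply (@bpair_step p y x a); auto. intros Lay.
  destruct (@atoms_join p y a b) as (c0 & C1 & C2 & C3 & C4); auto.
  assert (Lyx : le p y x) by (base p; lia).
  apply (@join_uniq p x a b c c0); auto; try aj; try (base p; lia).
  - intros <-. apply Nc. base p. lia.
  - apply (@le_trans p c0 y x); auto.
Qed.

Lemma bpair_two_nbrs u v : bpair u v -> d u v = 2 ->
  exists a b, a <> b /\ adj u a /\ adj a v /\ adj u b /\ adj b v.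
Proof.
  intros B H. inversion B as [|x z a Bx A Hx Aa La Na]; subst.
  { rewrite (dist_refl Hg) in H. lia. }
  assert (adj u x) by (apply (adj_dist Hg); lia).
  assert (adj a v) by (apply (adj_dist Hg); base u; lia).
  exists x, a. repeat split; auto. intros ->. apply Na. rewrite (dist_refl Hg). lia.
Qed.

(** * Gates, ranks and covers *)

Definition incl (X Y : V -> Prop) : Prop := forall x, X x -> Y x.

Definition gate (X : V -> Prop) (u : V) : V :=
  epsilon (inhabits u) (fun g => X g /\ forall y, X y -> le u g y).

Lemma gate_spec X u : gated adj X -> X (gate X u) /\ forall y, X y -> le u (gate X u) y.
Proof. intros G. exact (epsilon_spec (inhabits u) _ (G u)). Qed.

Lemma gate_in X u : gated adj X -> X (gate X u).
Proof. intros G. apply gate_spec; auto. Qed.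

Local Hint Extern 2 => match goal with |- ?X (gate ?X _) => apply gate_in end : core.

Lemma gate_le X u y : gated adj X -> X y -> le u (gate X u) y.
Proof. intros G. apply gate_spec; auto. Qed.

Lemma gate_uniq X u y : gated adj X -> X y -> d u y <= d u (gate X u) -> gate X u = y.
Proof. intros G Xy L. pose proof (gate_le u G Xy). apply (dist_eq0 Hg). lia. Qed.

Lemma gate_id X u : gated adj X -> X u -> gate X u = u.
Proof. intros G Xu. apply gate_uniq; auto. rewrite (dist_refl Hg). lia. Qed.

Lemma gate_gate X Y u : gated adj X -> gated adj Y -> incl X Y -> gate X (gate Y u) = gate X u.
Proof.
  intros GX GY I. symmetry. apply gate_uniq; auto.
  pose proof (gate_le (gate Y u) GX (gate_in u GX)).
  pose proof (gate_le u GY (I _ (gate_in u GX))).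
  pose proof (gate_le u GY (I _ (gate_in (gate Y u) GX))). lia.
Qed.

(** In particular a vertex outside a gated set has at most one neighbour in it. *)
Lemma gate_nbr X z t : gated adj X -> X z -> ~ X t -> adj z t -> gate X t = z.
Proof.
  intros G Xz Nt A. apply gate_uniq; auto. base t.
  assert (d t (gate X t) <> 0); [|lia].
  intros E. apply Nt. rewrite (dist_eq0 Hg E). apply gate_in; auto.
Qed.

(** Compose the two gates: the second stays in [X], as it lies on a geodesic from a point of [X] to
    [a]. *)
Lemma gated_inter X Y a : gated adj X -> gated adj Y -> X a -> Y a ->
  gated adj (fun x => X x /\ Y x).
Proof.
  intros GX GY Xa Ya x. exists (gate Y (gate X x)).
  assert (H : forall y, X y -> Y y -> le x (gate X x) y /\ le (gate X x) (gate Y (gate X x)) y).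
  { intros y Xy Yy. split; apply gate_le; auto. }
  assert (Xg : X (gate Y (gate X x))).
  { apply (@gated_convex X GX (gate X x) a); auto. apply H; auto. }
  split; [split; auto|]. intros y [Xy Yy]. unfold interval.
  destruct (H y) as [H1 H2]; auto. pose proof (gate_le x GX Xg). lia.
Qed.

(* For gated sets, thickness of the induced subgraph amounts to every pair being
   Boolean (see [boolean_gated_iff]); the empty set is gated when [V] is empty and is
   excluded here. *)
Definition bset (X : V -> Prop) : Prop :=
  gated adj X /\ (forall p q, X p -> X q -> bpair p q) /\ finite_diameter adj X /\ exists x, X x.

Lemma bset_gated X : bset X -> gated adj X.
Proof. intros H; apply H. Qed.

Local Hint Resolve bset_gated : core.

Lemma bset_sub Y Z : bset Y -> gated adj Z -> incl Z Y -> (exists z, Z z) -> bset Z.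
Proof.
  intros (G & B & (n & F) & _) GZ I N. repeat split; auto. exists n; auto.
Qed.

Lemma bset_inter X Y a : bset X -> gated adj Y -> X a -> Y a -> bset (fun x => X x /\ Y x).
Proof.
  intros BX GY Xa Ya. apply bset_sub with X; auto.
  - apply gated_inter with a; auto.
  - intros x []; auto.
  - exists a; auto.
Qed.

Definition is_diam (X : V -> Prop) (k : nat) : Prop :=
  (forall x y, X x -> X y -> d x y <= k) /\ exists x y, X x /\ X y /\ d x y = k.

Definition rk (X : V -> Prop) : nat := epsilon (inhabits 0) (is_diam X).

Lemma rk_spec X : bset X -> is_diam X (rk X).
Proof.
  intros (G & B & (n & F) & (x & Xx)). unfold rk. apply epsilon_spec.
  destruct (@least_nat (fun k => forall x y, X x -> X y -> d x y <= k)) as (k & H1 & H2).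
  { exists n; auto. }
  exists k. split; auto. destruct k as [|k].
  { exists x, x. rewrite (dist_refl Hg). auto. }
  apply NNPP. intros N. assert (S k <= k); [|lia]. apply H2. intros a b Xa Xb.
  specialize (H1 a b Xa Xb). destruct (eq_nat_dec (d a b) (S k)); [|lia].
  exfalso. apply N. eauto.
Qed.

Lemma rk_le X x y : bset X -> X x -> X y -> d x y <= rk X.
Proof. intros B. apply rk_spec; auto. Qed.

Lemma rk_eq X k : bset X -> is_diam X k -> rk X = k.
Proof.
  intros B (H1 & x & y & Xx & Xy & E).
  destruct (rk_spec B) as (H2 & x' & y' & Xx' & Xy' & E').
  specialize (H1 x' y' Xx' Xy'). specialize (H2 x y Xx Xy). lia.
Qed.

Lemma antipode X x : bset X -> X x -> exists y, X y /\ d x y = rk X.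
Proof.
  intros B Xx. apply NNPP. intros N.
  destruct (rk_spec B) as (H & a & b & Xa & Xb & E).
  assert (L : forall y, X y -> d x y < rk X).
  { intros y Xy. specialize (H x y Xx Xy). destruct (eq_nat_dec (d x y) (rk X)); [|lia].
    exfalso; eauto. }
  assert (d a b <= rk X - 1).
  { destruct B as (G & B & _). apply (@eccentricity_const X (rk X - 1) x a); auto.
    - apply gated_convex; auto.
    - intros y Xy. specialize (L y Xy). lia. }
  specialize (L x Xx). lia.
Qed.

(** The gate of [y] has such a neighbour, and the property spreads over [Z]: if [t] serves [z1],
    another midpoint of [z] and [t] serves [z], since [t] has only one neighbour in [Z]. *)
Lemma nbr_outside Y Z y z : bset Y -> gated adj Z -> incl Z Y -> Y y -> ~ Z y -> Z z ->
  exists t, Y t /\ ~ Z t /\ adj z t.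
Proof.
  intros (GY & BY & _) GZ I Yy Ny Zz.
  assert (CZ := gated_convex GZ). assert (CY := gated_convex GY).
  set (z0 := gate Z y). assert (Z0 : Z z0) by (apply gate_in; auto).
  assert (H0 : exists t, Y t /\ ~ Z t /\ adj z0 t).
  { destruct (@lower_step y z0) as (w & A & Hw); [intros E; apply Ny; rewrite E; auto|].
    destruct (d y z0) as [|n] eqn:E; [lia|].
    destruct (@geodesic_step _ _ Hg z0 y n) as (t & At & Ht); [rewrite (dist_sym Hg); auto|].
    exists t. repeat split; auto.
    - apply (CY z0 y); auto. base z0. tri z0 t y. lia.
    - intros Zt. pose proof (gate_le y GZ Zt) as L. fold z0 in L. tri y t z0. base y. lia. }
  clearbody z0. clear y Yy Ny. remember (d z0 z) as n eqn:E. revert z Zz E.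
  induction n as [|n IH]; intros z Zz E.
  { symmetry in E. rewrite <- (dist_eq0 Hg E). auto. }
  destruct (@lower_step z0 z) as (z1 & A & H1).
  { intros ->. rewrite (dist_refl Hg) in E. lia. }
  assert (Z1 : Z z1) by (apply (CZ z0 z); auto; base z0; lia).
  destruct (IH z1) as (t & Yt & Nt & At); auto; try lia.
  assert (Gt : gate Z t = z1) by (apply gate_nbr; auto).
  assert (Ht : d z t = 2).
  { pose proof (gate_le t GZ Zz) as L. rewrite Gt in L. base z. tri t z z1. tri z t z1. base z1. lia. }
  destruct (@bpair_two_nbrs z t) as (a & b & N & A1 & A2 & A3 & A4); auto.
  assert (exists c, c <> z1 /\ adj z c /\ adj c t) as (c & Nc & C1 & C2).
  { destruct (classic (a = z1)) as [->|]; [exists b|exists a]; auto. }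
  exists c. repeat split; auto.
  - apply (CY z t); auto. base z. lia.
  - intros Zc. apply Nc. rewrite <- Gt. symmetry. apply gate_nbr; auto.
Qed.

(** A neighbour [t] of [b] outside [Z] has gate [b], so it is one step further than [b] from [a]. *)
Lemma rk_lt Y Z y : bset Y -> bset Z -> incl Z Y -> Y y -> ~ Z y -> rk Z < rk Y.
Proof.
  intros BY BZ I Yy Ny. destruct (rk_spec BZ) as (_ & a & b & Za & Zb & E).
  destruct (@nbr_outside Y Z y b) as (t & Yt & Nt & At); auto.
  pose proof (gate_nbr (bset_gated BZ) Zb Nt At) as Gt.
  pose proof (gate_le t (bset_gated BZ) Za) as L. rewrite Gt in L.
  pose proof (rk_le BY (I a Za) Yt). base a. tri t b a. tri a t b. lia.
Qed.

Lemma rk_eq_incl Y Z : bset Y -> bset Z -> incl Z Y -> rk Y <= rk Z -> incl Y Z.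
Proof.
  intros BY BZ I L y Yy. apply NNPP. intros N. pose proof (rk_lt BY BZ I Yy N). lia.
Qed.

Lemma rk_mono Y Z : bset Y -> bset Z -> incl Z Y -> rk Z <= rk Y.
Proof.
  intros BY BZ I. destruct (rk_spec BZ) as (_ & a & b & Za & Zb & <-). apply rk_le; auto.
Qed.

(** The intersection with [W] keeps a diametral pair, hence the rank, so it is all of [X]. *)
Lemma hull_min X W p q : bset X -> X p -> X q -> d p q = rk X -> gated adj W -> W p -> W q ->
  incl X W.
Proof.
  intros BX Xp Xq E GW Wp Wq.
  assert (B : bset (fun x => X x /\ W x)) by (apply bset_inter with p; auto).
  assert (I : incl X (fun x => X x /\ W x)).
  { apply rk_eq_incl; auto; [intros x []; auto|]. rewrite <- E. apply rk_le; auto. }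
  intros x Xx. apply I; auto.
Qed.

Lemma bpair_bset p q : bpair p q -> exists X, bset X /\ X p /\ X q /\ rk X = d p q.
Proof.
  intros B. destruct (bpair_hull B) as (X & G & Xp & Xq & H).
  assert (BX : bset X).
  { repeat split; auto; try (intros; apply H; auto). 2: eauto.
    exists (d p q). intros; apply H; auto. }
  exists X. split; [auto|split; [auto|split; auto]]. apply rk_eq; auto. split.
  - intros; apply H; auto.
  - exists p, q; auto.
Qed.

(** Covering expressed through rank; [covers_iff] relates it to the order-theoretic notion. *)
Definition cov (X Y : V -> Prop) : Prop := incl X Y /\ rk Y = S (rk X).

Lemma cov_proper X Y : bset X -> bset Y -> cov X Y -> exists y, Y y /\ ~ X y.
Proof.
  intros BX BY [I E]. apply NNPP. intros N.
  assert (incl Y X) by (intros y Yy; apply NNPP; intros Ny; eauto).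
  pose proof (rk_mono BX BY). specialize (H0 H). lia.
Qed.

(** Since [s] is the gate of [t], the pair [s'], [t] has distance [rk Z + 1]; its hull is the cover
    sought. *)
Lemma extend Z s s' t : bset Z -> Z s -> Z s' -> d s' s = rk Z -> ~ Z t -> adj s t ->
  bpair s' t -> exists X, bset X /\ cov Z X /\ X t /\
    forall W, gated adj W -> incl Z W -> W t -> incl X W.
Proof.
  intros BZ Zs Zs' E Nt A B.
  assert (Gt : gate Z t = s) by (apply gate_nbr; auto).
  assert (Ht : d s' t = S (rk Z)).
  { pose proof (gate_le t (bset_gated BZ) Zs') as L. rewrite Gt in L. base s'. tri t s s'. lia. }
  destruct (bpair_bset B) as (X & BX & Xs' & Xt & HX). exists X.
  assert (Xs : X s).
  { apply (gated_convex (bset_gated BX) Xs' Xt). base s'. tri s s' t. lia. }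
  split; [auto|]. split.
  - split; [|lia]. apply (@hull_min Z X s' s); auto.
  - split; auto. intros W GW I Wt. apply (@hull_min X W s' t); auto.
Qed.

Lemma extend_in W Z s t : bset W -> bset Z -> incl Z W -> Z s -> W t -> ~ Z t -> adj s t ->
  exists X, bset X /\ cov Z X /\ X t /\ incl X W.
Proof.
  intros BW BZ I Zs Wt Nt A. destruct (antipode BZ Zs) as (s' & Zs' & E).
  destruct (@extend Z s s' t) as (X & BX & C & Xt & M); auto.
  - rewrite (dist_sym Hg). auto.
  - apply BW; auto.
  - exists X. repeat (split; [assumption|]). apply M; auto.
Qed.

(** An antipode in [X] of the gate of [y] is at distance [rk X + d y (gate X y)] from [y], which is
    at most [rk X + 1]. *)
Lemma cov_near X Y y : bset X -> bset Y -> cov X Y -> Y y -> ~ X y -> adj (gate X y) y.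
Proof.
  intros BX BY [I E] Yy Ny. pose proof (bset_gated BX) as G.
  destruct (@antipode X (gate X y)) as (x & Xx & H); auto.
  pose proof (gate_le y G Xx). pose proof (rk_le BY Yy (I x Xx)).
  assert (d y (gate X y) <> 0).
  { intros D. apply Ny. rewrite (dist_eq0 Hg D). apply gate_in; auto. }
  apply (adj_sym Hg), (adj_dist Hg). lia.
Qed.

Lemma near_cov A Y y : bset A -> bset Y -> incl A Y -> Y y -> ~ A y ->
  (forall y, Y y -> exists a, A a /\ d y a <= 1) -> cov A Y.
Proof.
  intros BA BY I Yy Ny H. split; auto. pose proof (rk_lt BY BA I Yy Ny).
  destruct BA as (GA & ? & ? & a & Aa). destruct (@antipode Y a) as (x & Yx & E); auto.
  destruct (H x) as (b & Ab & L); auto.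
  assert (BA : bset A) by (repeat split; eauto).
  pose proof (rk_le BA Aa Ab). tri a b x. lia.
Qed.

Lemma cov_between T X x : bset X -> bset T -> incl T X -> X x -> ~ T x ->
  exists Y, bset Y /\ incl T Y /\ cov Y X.
Proof.
  intros BX BT I Xx Nx. remember (rk X - rk T) as n eqn:E. revert T BT I x Xx Nx E.
  induction n as [|n IH]; intros T BT I x Xx Nx E.
  { pose proof (rk_lt BX BT I Xx Nx). lia. }
  destruct (classic (cov T X)) as [C|NC].
  { exists T. split; [auto|split; [intros ? ?; auto|auto]]. }
  pose proof BT as (_ & _ & _ & s & Ts).
  destruct (@nbr_outside X T x s) as (t & Xt & Nt & A); auto.
  destruct (@extend_in X T s t) as (T' & BT' & [I1 C1] & T't & I2); auto.
  assert (exists y, X y /\ ~ T' y) as (y & Xy & Ny).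
  { apply NNPP. intros N. apply NC. split; auto.
    assert (incl X T') by (intros y Xy; apply NNPP; intros Ny; eauto).
    pose proof (rk_mono BT' BX ltac:(auto)). pose proof (rk_mono BX BT' ltac:(auto)). lia. }
  destruct (IH T' BT' I2 y) as (Y & BY & J & C); auto; try lia.
  exists Y. split; [auto|]. split; auto. intros z Tz. auto.
Qed.

(** * Mutual projections and the distance formula *)

Definition proj (X U : V -> Prop) (x : V) : Prop := exists u, U u /\ x = gate X u.

Definition sdist (U X : V -> Prop) : nat :=
  epsilon (inhabits 0) (fun n => (exists u, U u /\ d u (gate X u) = n) /\
                                 forall u, U u -> n <= d u (gate X u)).

Lemma sdist_spec U X : (exists u, U u) ->
  (exists u, U u /\ d u (gate X u) = sdist U X) /\ forall u, U u -> sdist U X <= d u (gate X u).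
Proof.
  intros [u Uu]. unfold sdist. apply epsilon_spec.
  destruct (@least_nat (fun n => exists u, U u /\ d u (gate X u) = n)) as (n & H1 & H2); eauto.
  exists n. split; auto. intros v Uv. apply H2. eauto.
Qed.

Lemma sdist_eq U X n : (exists u, U u /\ d u (gate X u) = n) ->
  (forall u, U u -> n <= d u (gate X u)) -> sdist U X = n.
Proof.
  intros (u & Uu & E) H. destruct (@sdist_spec U X) as ((v & Uv & E') & H'); [eauto|].
  specialize (H v Uv). specialize (H' u Uu). lia.
Qed.

Lemma sdist_le U X u x : gated adj X -> U u -> X x -> sdist U X <= d u x.
Proof.
  intros G Uu Xx. destruct (@sdist_spec U X) as (_ & H); [eauto|].
  specialize (H u Uu). pose proof (gate_le u G Xx). lia.
Qed.

(** Comparing [x] and its gate [u1] with a closest pair [u0], [x0], the gate identities add up to 2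
    d(x,u1) <= 2 d(u0,x0). *)
Lemma proj_dist U X x : gated adj U -> gated adj X -> proj X U x -> d x (gate U x) = sdist U X.
Proof.
  intros GU GX (u & Uu & ->). set (x := gate X u).
  assert (Xx : X x) by (apply gate_in; auto).
  destruct (@sdist_spec U X) as ((u0 & Uu0 & E) & H); [eauto|].
  set (x0 := gate X u0) in *. assert (Xx0 : X x0) by (apply gate_in; auto).
  set (u1 := gate U x). assert (Uu1 : U u1) by (apply gate_in; auto).
  pose proof (gate_le u GX Xx0) as H1. fold x in H1.
  pose proof (gate_le u0 GX Xx) as H2. fold x0 in H2.
  pose proof (gate_le x GU Uu) as H3. pose proof (gate_le x GU Uu0) as H4. fold u1 in H3, H4.
  assert (Eg : gate U x0 = u0).
  { apply gate_uniq; auto. rewrite (dist_sym Hg), E, (dist_sym Hg).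
    apply sdist_le; auto. }
  pose proof (gate_le x0 GU Uu) as H5. rewrite Eg in H5.
  pose proof (sdist_le GX Uu1 Xx) as H6.
  tri u u1 u0. tri x u u1. tri x x0 u. tri x x0 u0. tri u u0 x0. tri x u1 u0. lia.
Qed.

Lemma proj_intro U X x : gated adj U -> gated adj X -> X x -> d x (gate U x) <= sdist U X ->
  proj X U x /\ gate X (gate U x) = x.
Proof.
  intros GU GX Xx E. assert (gate X (gate U x) = x).
  { apply gate_uniq; auto. rewrite (dist_sym Hg). destruct (@sdist_spec U X) as (_ & H); [exists (gate U x); auto|].
    specialize (H (gate U x) ltac:(auto)). lia. }
  split; auto. exists (gate U x); auto.
Qed.

Lemma proj_in U X x : gated adj X -> proj X U x -> X x.
Proof. intros G (u & _ & ->). auto. Qed.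

Lemma proj_mate U X x : gated adj U -> gated adj X -> proj X U x -> gate X (gate U x) = x.
Proof.
  intros GU GX P. destruct (@proj_intro U X x) as [_ H]; auto.
  - apply (proj_in GX P).
  - rewrite (proj_dist GU GX P); lia.
Qed.

Lemma proj_iso U X x y : gated adj U -> gated adj X -> proj X U x -> proj X U y ->
  d (gate U x) (gate U y) = d x y.
Proof.
  intros GU GX Px Py.
  pose proof (proj_dist GU GX Px) as Ex. pose proof (proj_dist GU GX Py) as Ey.
  pose proof (gate_le (gate U x) GX (proj_in GX Py)) as H1. rewrite (proj_mate GU GX Px) in H1.
  pose proof (gate_le y GU (gate_in x GU)) as H2.
  tri (gate U x) x y. tri (gate U y) (gate U x) y. lia.
Qed.

(** The gate is reached by going to [X], across to [U] and back. Subtracting the instance of [K] at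
    [x1] from that at [x'] leaves the gate identity. *)
Lemma proj_gated U X : gated adj U -> gated adj X -> gated adj (proj X U).
Proof.
  intros GU GX z. set (x := gate X z). set (y := gate U x). set (x1 := gate X y).
  assert (P1 : proj X U x1) by (exists y; unfold y; auto).
  assert (K : forall x', proj X U x' -> d x x' + 2 * sdist U X = d x y + d y x1 + d x1 x').
  { intros x' P'. pose proof (proj_dist GU GX P'). pose proof (proj_mate GU GX P') as M.
    assert (X x) by (apply gate_in; auto).
    pose proof (gate_le (gate U x') GX H0). rewrite M in H1.
    pose proof (gate_le x GU (gate_in x' GU)). fold y in H2.
    pose proof (gate_le y GX (proj_in GX P')). fold x1 in H3.
    pose proof (gate_le x' GU (gate_in x GU)). fold y in H4.
    tri x' (gate U x') x. tri x' (gate U x') y. lia. }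
  exists x1. split; auto. intros x' P'. unfold interval.
  pose proof (K x' P'). pose proof (K x1 P1). rewrite (dist_refl Hg) in H0.
  pose proof (gate_le z GX (proj_in GX P')). pose proof (gate_le z GX (proj_in GX P1)).
  fold x in H1, H2. lia.
Qed.

Lemma proj_bset U X : gated adj U -> (exists u, U u) -> bset X -> bset (proj X U).
Proof.
  intros GU [u Uu] BX. apply bset_sub with X; auto.
  - apply proj_gated; auto.
  - intros x P. apply (proj_in (bset_gated BX) P).
  - exists (gate X u), u; auto.
Qed.

Lemma rk_embed A B (phi : V -> V) : bset A -> bset B -> (forall x, A x -> B (phi x)) ->
  (forall x y, A x -> A y -> d (phi x) (phi y) = d x y) -> rk A <= rk B.
Proof.
  intros BA BB I E. destruct (rk_spec BA) as (_ & x & y & Ax & Ay & <-).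
  rewrite <- E; auto. apply rk_le; auto.
Qed.

Lemma rk_proj_le U X : bset U -> bset X -> rk (proj X U) <= rk U.
Proof.
  intros BU BX. apply rk_embed with (gate U); auto.
  - apply proj_bset; auto. apply BU.
  - intros x y Px Py. apply (@proj_iso U X); auto.
Qed.

Lemma rk_proj_le' U X : bset U -> bset X -> rk (proj X U) <= rk X.
Proof.
  intros BU BX. apply rk_mono; auto.
  - apply proj_bset; auto. apply BU.
  - intros x Px. apply (proj_in (bset_gated BX) Px).
Qed.

Lemma set_ext (X Y : V -> Prop) : (forall x, X x <-> Y x) -> X = Y.
Proof.
  intros H. apply functional_extensionality. intros x. apply propositional_extensionality, H.
Qed.

(* Twice the distance of [U] and [X], plus the codimensions of their mutual projections,
   which are isometric. The subtraction is not truncated, by [rk_proj_le] and [rk_proj_le']. *)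
Definition bdist (U X : V -> Prop) : nat := 2 * sdist U X + rk U + rk X - 2 * rk (proj X U).

Lemma gate_sub_eq X Y u : gated adj X -> gated adj Y -> incl X Y -> X (gate Y u) ->
  gate X u = gate Y u.
Proof.
  intros GX GY I H. apply gate_uniq; auto.
  pose proof (gate_le u GY (I _ (gate_in u GX))). lia.
Qed.

Lemma bdist_down U X Y : bset U -> bset X -> bset Y -> cov X Y ->
  (forall u, U u -> X (gate Y u)) -> bdist U Y = S (bdist U X).
Proof.
  intros BU BX BY [I E] H.
  assert (Eg : forall u, U u -> gate X u = gate Y u).
  { intros u Uu. apply gate_sub_eq; auto. }
  assert (Ep : proj X U = proj Y U).
  { apply set_ext. intros x. split; intros (u & Uu & ->); exists u; split; auto; symmetry; auto. }
  assert (Es : sdist U X = sdist U Y).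
  { destruct BU as (_ & _ & _ & NU). destruct (@sdist_spec U Y) as ((v & Uv & Ev) & M); auto.
    apply sdist_eq.
    - exists v. rewrite Eg; auto.
    - intros u Uu. rewrite Eg; auto. }
  pose proof (rk_proj_le BU BX). pose proof (rk_proj_le' BU BX).
  unfold bdist. rewrite Es, Ep in *. lia.
Qed.

(** If the projection of [U] to [Y] meets [X], passing to [X] lowers the projection rank by one; if
    not, the distance grows by one and the projection rank stays. Either change adds 2, and the
    smaller [rk X] takes 1 away. *)
Lemma bdist_up U X Y u0 : bset U -> bset X -> bset Y -> cov X Y -> U u0 -> ~ X (gate Y u0) ->
  bdist U X = S (bdist U Y).
Proof.
  intros BU BX BY C Uu0 N. pose proof C as [I E].
  pose proof (bset_gated BU) as GU. pose proof (bset_gated BX) as GX. pose proof (bset_gated BY) as GY.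
  assert (BT : bset (proj Y U)) by (apply proj_bset; eauto).
  pose proof (bset_gated BT) as GT.
  assert (T0 : proj Y U (gate Y u0)) by (exists u0; auto).
  assert (TY : incl (proj Y U) Y) by (intros t Pt; apply (proj_in GY Pt)).
  assert (NU : exists u, U u) by eauto.
  destruct (@sdist_spec U Y NU) as ((v & Uv & Ev) & M).
  pose proof (rk_proj_le BU BX). pose proof (rk_proj_le' BU BX).
  pose proof (rk_proj_le BU BY). pose proof (rk_proj_le' BU BY).
  destruct (classic (exists s, proj Y U s /\ X s)) as [(s & Ts & Xs)|Dj].
  - assert (Es : sdist U X = sdist U Y).
    { apply sdist_eq.
      - exists (gate U s). split; auto.
        rewrite <- (@gate_gate X Y), (@proj_mate U Y), (@gate_id X); auto.
        rewrite (dist_sym Hg). apply proj_dist; auto.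
      - intros u Uu. specialize (M u Uu). pose proof (gate_le u GY (I _ (gate_in u GX))). lia. }
    assert (Ep : proj X U = fun x => proj Y U x /\ X x).
    { apply set_ext. intros x. split.
      - intros (u & Uu & ->). split; auto. rewrite <- (@gate_gate X Y); auto.
        apply (gated_convex GT (x := gate Y u) (y := s)); auto.
        + exists u; auto.
        + apply gate_le; auto.
      - intros [(u & Uu & ->) Xx]. exists u. split; auto. symmetry. apply gate_sub_eq; auto. }
    assert (CT : cov (proj X U) (proj Y U)).
    { apply near_cov with (gate Y u0); auto.
      - apply proj_bset; auto.
      - rewrite Ep. intros x []; auto.
      - rewrite Ep. intros []; auto.
      - intros t Tt. rewrite Ep. destruct (classic (X t)) as [Xt|Nt].
        + exists t. rewrite (dist_refl Hg). auto.
        + exists (gate X t). split; [split; auto|].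
          * apply (gated_convex GT (x := t) (y := s)); auto. apply gate_le; auto.
          * assert (A : adj (gate X t) t) by (apply cov_near with Y; auto). base t. lia. }
    destruct CT as [_ CT]. unfold bdist. rewrite Es in *. lia.
  - assert (D1 : forall t, proj Y U t -> d t (gate X t) = 1).
    { intros t Tt. apply (dist_adj Hg). apply (adj_sym Hg). apply cov_near with Y; auto.
      intros Xt. apply Dj; eauto. }
    assert (D2 : forall u, U u -> d u (gate X u) = S (d u (gate Y u))).
    { intros u Uu. pose proof (gate_le u GY (I _ (gate_in u GX))).
      pose proof (D1 (gate Y u) ltac:(exists u; auto)). rewrite (@gate_gate X Y) in H4; auto. lia. }
    assert (Es : sdist U X = S (sdist U Y)).
    { apply sdist_eq; [exists v; rewrite D2; auto|]. intros u Uu. rewrite D2; auto.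
      specialize (M u Uu). lia. }
    assert (Et : sdist X (proj Y U) = 1).
    { apply sdist_eq.
      - set (t := gate Y u0). exists (gate X t). split; auto.
        assert (d (gate X t) (gate (proj Y U) (gate X t)) <= 1).
        { pose proof (gate_le (gate X t) GT T0). fold t in H3.
          pose proof (D1 t T0). tri t (gate X t) t. lia. }
        assert (d (gate X t) (gate (proj Y U) (gate X t)) <> 0); [|lia].
        intros D0. apply Dj. exists (gate X t). split; auto.
        rewrite (dist_eq0 Hg D0). auto.
      - intros x Xx. destruct (d x (gate (proj Y U) x)) eqn:D0; [|lia].
        exfalso. apply Dj. exists x. split; auto. rewrite (dist_eq0 Hg D0). auto. }
    assert (L1 : rk (proj Y U) <= rk (proj X U)).
    { apply rk_embed with (gate X); auto.
      - apply proj_bset; auto.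
      - intros t (u & Uu & ->). exists u. rewrite (@gate_gate X Y); auto.
      - intros t t' Tt Tt'. apply (@proj_iso X (proj Y U)); auto; apply proj_intro; auto;
          rewrite D1; auto; lia. }
    assert (L2 : rk (proj X U) <= rk (proj Y U)).
    { assert (Q : forall x, proj X U x -> proj X (proj Y U) x).
      { intros x (u & Uu & ->). exists (gate Y u). rewrite (@gate_gate X Y); auto.
        split; auto. exists u; auto. }
      apply rk_embed with (gate (proj Y U)); auto.
      - apply proj_bset; auto.
      - intros x x' Px Px'. apply (@proj_iso (proj Y U) X); auto. }
    unfold bdist. lia.
Qed.

Lemma bdist_parity U X Y : bset U -> bset X -> bset Y -> cov X Y ->
  (bdist U Y = S (bdist U X) /\ forall u, U u -> X (gate Y u)) \/
  (bdist U X = S (bdist U Y) /\ exists u, U u /\ ~ X (gate Y u)).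
Proof.
  intros BU BX BY C. destruct (classic (exists u, U u /\ ~ X (gate Y u))) as [(u & Uu & N)|N].
  - right. split; [apply bdist_up with u; auto|eauto].
  - left. assert (H : forall u, U u -> X (gate Y u)).
    { intros u Uu. apply NNPP. eauto. }
    split; auto. apply bdist_down; auto.
Qed.

(* When all of [X] is at distance [sdist U X > 0] from [U], moving [X] one step
   towards [U] sweeps out a minimal strict superset of [X] in B(G). *)
Lemma cov_towards U X : bset U -> bset X -> incl X (proj X U) -> sdist U X <> 0 ->
  exists Y u, bset Y /\ cov X Y /\ U u /\ ~ X (gate Y u).
Proof.
  intros BU BX I D. pose proof BX as (GX & BB & _ & x & Xx). pose proof (bset_gated BU) as GU.
  assert (Dx : forall y, X y -> d y (gate U y) = sdist U X).
  { intros y Xy. apply proj_dist; auto. }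
  set (u := gate U x).
  destruct (sdist U X) as [|n] eqn:En; [lia|].
  destruct (@geodesic_step _ _ Hg x u n) as (x1 & A1 & H1); [apply Dx; auto|].
  assert (N1 : ~ X x1).
  { intros X1. pose proof (Dx x1 X1). pose proof (gate_le x1 GU (gate_in x GU)). fold u in H0. lia. }
  destruct (antipode BX Xx) as (x' & Xx' & Hx').
  set (u' := gate U x').
  assert (Iu : d u u' = d x x') by (apply (@proj_iso U X); auto).
  assert (Iv : d u' x = S n + d x x').
  { pose proof (gate_le u' GX Xx) as L. assert (M : gate X u' = x') by (apply (@proj_mate U X); auto).
    rewrite M in L. pose proof (Dx x' Xx'). fold u' in H. tri x x' u'. lia. }
  assert (Iw : d x' x1 = S (d x x')).
  { pose proof (gate_le x1 GX Xx') as L. rewrite (gate_nbr GX Xx N1 A1) in L.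
    base x. tri x' x1 x. lia. }
  assert (Hu1 : d u' x = S (d u' x1)).
  { tri u' x1 u. tri x1 u x. base u'. lia. }
  pose proof (Dx x' Xx') as Hxu. fold u' in Hxu.
  (* [a] moves [x'] towards [u'] in parallel with the step from [x] to [x1]; it is the new atom
     making the pair [x'], [x1] Boolean. *)
  destruct (@meet_coatom u' x1 x x') as (a & A2 & H2 & L2); auto; try aj.
  { tri u' x' x. lia. } { tri u' x' x. lia. }
  assert (B1 : bpair x' x1).
  { apply (@bpair_step x' x x1 a); auto; try aj.
    - tri x x' u. lia.
    - base a. base x'. tri u' x' a. tri u' a x1. tri u' x' x. lia.
    - intros L. assert (Xa : X a) by (apply (gated_convex GX Xx' Xx); auto).
      pose proof (Dx a Xa). pose proof (gate_le a GU (gate_in x' GU)). fold u' in H0.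
      tri u' a x'. lia. }
  destruct (@extend X x x' x1) as (Y & BY & C & Y1 & _); auto.
  { tri x x' u. lia. }
  exists Y, u. split; [auto|]. split; [auto|]. split; [unfold u; auto|].
  intros XY. pose proof (gate_le u (bset_gated BY) Y1).
  pose proof (sdist_le GX (gate_in x GU) XY). fold u in H0. tri u x1 x. lia.
Qed.

(** Shrink [X] around a proper projection; if the projection is all of [X], step towards [U] when
    they are apart, and otherwise grow [X] inside [U]. *)
Lemma bdist_descend U X : bset U -> bset X -> X <> U ->
  exists Y, bset Y /\ (cov X Y \/ cov Y X) /\ bdist U X = S (bdist U Y).
Proof.
  intros BU BX N. pose proof (bset_gated BU) as GU. pose proof (bset_gated BX) as GX.
  assert (BT : bset (proj X U)) by (apply proj_bset; auto; apply BU).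
  assert (I : incl (proj X U) X) by (intros t Pt; apply (proj_in GX Pt)).
  destruct (classic (exists x, X x /\ ~ proj X U x)) as [(x & Xx & Nx)|P].
  { destruct (@cov_between (proj X U) X x) as (Y & BY & IY & C); auto.
    exists Y. split; [auto|]. split; [auto|]. apply bdist_down; auto.
    intros u Uu. apply IY. exists u; auto. }
  assert (I' : incl X (proj X U)) by (intros x Xx; apply NNPP; eauto).
  assert (exists Y u, bset Y /\ cov X Y /\ U u /\ ~ X (gate Y u)) as (Y & u & BY & C & Uu & Nu).
  2:{ exists Y. split; [auto|]. split; [auto|]. apply bdist_up with u; auto. }
  destruct (eq_nat_dec (sdist U X) 0) as [D|D]; [|apply cov_towards; auto].
  assert (XU : incl X U).
  { intros x Xx. assert (D' : d x (gate U x) = 0) by (rewrite <- D; apply proj_dist; auto).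
    rewrite (dist_eq0 Hg D'). auto. }
  assert (exists t, U t /\ ~ X t) as (t0 & Ut0 & Nt0).
  { apply NNPP. intros F. apply N, set_ext. intros y; split; auto.
    intros Uy. apply NNPP. eauto. }
  pose proof BX as (_ & _ & _ & s & Xs).
  destruct (@nbr_outside U X t0 s) as (t & Ut & Nt & A); auto.
  destruct (@extend_in U X s t) as (Y & BY & C & Yt & IY); auto.
  exists Y, t. repeat (split; [auto|]). rewrite gate_id; auto.
Qed.

(** * The quadrangle condition *)

(** The intersection is strictly larger than [Z], so it already has the rank of both covers. *)
Lemma cov_inter_eq Z V1 V2 v : bset Z -> bset V1 -> bset V2 -> cov Z V1 -> cov Z V2 ->
  V1 v -> V2 v -> ~ Z v -> V1 = V2.
Proof.
  intros BZ B1 B2 [I1 E1] [I2 E2] H1 H2 N.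
  assert (B : bset (fun x => V1 x /\ V2 x)) by (apply bset_inter with v; auto).
  assert (L : rk Z < rk (fun x => V1 x /\ V2 x)) by (apply rk_lt with v; auto; intros x; split; auto).
  assert (J1 : incl V1 (fun x => V1 x /\ V2 x)).
  { apply rk_eq_incl; auto; [intros x []; auto|lia]. }
  assert (J2 : incl V2 (fun x => V1 x /\ V2 x)).
  { apply rk_eq_incl; auto; [intros x []; auto|lia]. }
  apply set_ext. intros x; split; intros Hx; [apply J1|apply J2]; auto.
Qed.

(** Both [V1] and [V2] contain every gate in [Z] of a point of [U]; their intersection is the set
    required. *)
Lemma qc_below U Z V1 V2 : bset U -> bset Z -> bset V1 -> bset V2 -> cov V1 Z -> cov V2 Z ->
  V1 <> V2 -> bdist U Z = S (bdist U V1) -> bdist U V2 = bdist U V1 ->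
  exists X, bset X /\ cov X V1 /\ cov X V2 /\ bdist U V1 = S (bdist U X).
Proof.
  intros BU BZ B1 B2 C1 C2 N E1 E2. pose proof BU as (GU & _ & _ & u & Uu).
  destruct (bdist_parity BU B1 BZ C1) as [[_ H1]|[? _]]; [|lia].
  destruct (bdist_parity BU B2 BZ C2) as [[_ H2]|[? _]]; [|lia].
  assert (BX : bset (fun x => V1 x /\ V2 x)) by (apply bset_inter with (gate Z u); auto).
  pose proof C1 as [I1 R1]. pose proof C2 as [I2 R2].
  assert (K : forall A B, bset A -> bset B -> cov A Z -> cov B Z -> A (gate Z u) -> B (gate Z u) ->
     A <> B -> bset (fun x => A x /\ B x) -> cov (fun x => A x /\ B x) A).
  { intros A B BA BB CA CB Au Bu NAB BAB.
    assert (exists y, A y /\ ~ B y) as (y & Ay & Ny).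
    { apply NNPP. intros F. apply NAB, set_ext.
      assert (J : incl A B) by (intros y Ay; apply NNPP; eauto).
      assert (J' : incl B A) by (apply rk_eq_incl; auto; destruct CA, CB; lia).
      intros y; split; auto. }
    apply near_cov with y; auto; [intros x []; auto|intros []; auto|].
    intros a Aa. destruct (classic (B a)) as [Ba|Na].
    { exists a. rewrite (dist_refl Hg). auto. }
    exists (gate B a). split; [split; auto|].
    - apply (gated_convex (bset_gated BA) Aa Au). apply gate_le; auto.
    - assert (Q : adj (gate B a) a) by (apply cov_near with Z; auto; apply CA; auto). base a. lia. }
  exists (fun x => V1 x /\ V2 x).
  assert (Cx1 : cov (fun x => V1 x /\ V2 x) V1) by (apply K; auto).
  split; [auto|]. split; [auto|]. split.
  - replace (fun x => V1 x /\ V2 x) with (fun x => V2 x /\ V1 x).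
    2:{ apply set_ext. intros; tauto. }
    apply K; auto. apply bset_inter with (gate Z u); auto.
  - apply bdist_down; auto. intros t Ut.
    rewrite (@gate_sub_eq V1 Z); auto.
Qed.

(** [t] is a gate in [W] outside [Z] whose own gate in [Z] lies in [V1]; extending [V1] by [t]
    inside [W] goes round the square the other way. *)
Lemma qc_through U Z V1 W : bset U -> bset Z -> bset V1 -> bset W -> cov V1 Z -> cov Z W ->
  bdist U Z = S (bdist U V1) -> bdist U W = bdist U V1 ->
  exists X, bset X /\ cov V1 X /\ cov X W /\ bdist U V1 = S (bdist U X).
Proof.
  intros BU BZ BV BW C1 C2 E1 E2.
  destruct (bdist_parity BU BV BZ C1) as [[_ H1]|[? _]]; [|lia].
  destruct (bdist_parity BU BZ BW C2) as [[? _]|[_ (u & Uu & Nu)]]; [lia|].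
  pose proof C1 as [I1 R1]. pose proof C2 as [I2 R2].
  set (t := gate W u) in *. assert (Wt : W t) by (apply gate_in; auto).
  assert (A : adj (gate Z t) t) by (apply cov_near with W; auto).
  assert (Vs : V1 (gate Z t)) by (unfold t; rewrite gate_gate; auto).
  destruct (@extend_in W V1 (gate Z t) t) as (X & BX & C & Xt & IX); auto.
  { intros x Vx. auto. }
  exists X. split; [auto|]. split; [auto|]. split.
  - split; auto. destruct C. lia.
  - apply bdist_up with u; auto. intros VX. apply Nu.
    apply I1. fold t in Xt. unfold t. rewrite <- (@gate_sub_eq X W); auto.
Qed.

(** If the gate of [m] in the cover leaves [Z], it is the nearer [v]. Otherwise the projection of
    [U] contains [z] and leaves [Z], which gives an edge [zv] parallel to an edge of [U] at [m]. *)
Lemma nearby_direction U Z V1 m z u1 : bset U -> bset Z -> bset V1 -> cov Z V1 -> U m -> Z z ->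
  (forall u x, U u -> Z x -> d m z <= d u x) -> U u1 -> ~ Z (gate V1 u1) ->
  exists v, V1 v /\ ~ Z v /\ adj z v /\
    (S (d m v) = d m z \/ exists u, U u /\ adj m u /\ d u v = d m z).
Proof.
  intros BU BZ BV C Um Zz Min Uu1 N1. pose proof C as [I R].
  pose proof (bset_gated BU) as GU. pose proof (bset_gated BZ) as GZ. pose proof (bset_gated BV) as GV.
  assert (Em : gate Z m = z) by (apply gate_uniq; auto).
  assert (Eu : gate U z = m).
  { apply gate_uniq; auto. rewrite (dist_sym Hg), (dist_sym Hg z). auto. }
  destruct (classic (Z (gate V1 m))) as [Zg|Ng].
  - assert (Eg : gate V1 m = z) by (rewrite <- Em; symmetry; apply gate_sub_eq; auto).
    assert (BT : bset (proj V1 U)) by (apply proj_bset; eauto).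
    assert (Tz : proj V1 U z) by (exists m; auto).
    assert (Is : incl (fun x => proj V1 U x /\ Z x) (proj V1 U)) by (intros x []; auto).
    destruct (@nbr_outside (proj V1 U) (fun x => proj V1 U x /\ Z x) (gate V1 u1) z)
      as (v & Tv & Nv & A); auto.
    { apply gated_inter with z; auto. }
    { exists u1; auto. } { intros []; auto. }
    exists v. split; [apply (proj_in GV Tv)|]. split; [auto|]. split; auto. right.
    exists (gate U v). split; [auto|]. split.
    + apply (adj_dist Hg). rewrite <- Eu, (@proj_iso U V1); auto. apply (dist_adj Hg); auto.
    + rewrite (dist_sym Hg), (@proj_dist U V1); auto.
      rewrite <- (@proj_dist U V1 z), Eu; auto. apply (dist_sym Hg).
  - exists (gate V1 m).
    assert (A : adj (gate Z (gate V1 m)) (gate V1 m)) by (apply cov_near with V1; auto).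
    rewrite gate_gate, Em in A; auto.
    split; [auto|]. split; [auto|]. split; [auto|]. left.
    pose proof (gate_le m GV (I z Zz)). base m. tri m (gate V1 m) z. lia.
Qed.

(** [Fin] reduces the claim to a base point [b] to which [v] and [w] are both nearer than [z]; the
    cases look for it at or near [m] in [U]. *)
Lemma square_above U Z V1 V2 u1 u2 : bset U -> bset Z -> bset V1 -> bset V2 ->
  cov Z V1 -> cov Z V2 -> (forall x, V1 x -> V2 x -> Z x) ->
  U u1 -> ~ Z (gate V1 u1) -> U u2 -> ~ Z (gate V2 u2) ->
  exists z v w y, Z z /\ V1 v /\ ~ Z v /\ V2 w /\ ~ Z w /\ adj z v /\ adj z w /\
    adj y v /\ adj y w /\ y <> z.
Proof.
  intros BU BZ B1 B2 C1 C2 NI U1 N1 U2 N2.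
  pose proof (bset_gated BU) as GU. pose proof (bset_gated BZ) as GZ.
  pose proof (bset_gated B1) as G1. pose proof C1 as [I1 _].
  assert (exists m z, U m /\ Z z /\ forall u x, U u -> Z x -> d m z <= d u x) as (m & z & Um & Zz & Min).
  { pose proof BZ as (_ & _ & _ & z0 & Zz0).
    destruct (@least_nat (fun n => exists m z, U m /\ Z z /\ d m z = n)) as (n & (m & z & Um & Zz & E) & M).
    { exists (d u1 z0), u1, z0. auto. }
    exists m, z. split; [auto|]. split; [auto|]. intros u x Uu Zx. rewrite E. apply M; eauto. }
  assert (Eu : forall u, U u -> d u z = d m z + d m u).
  { intros u Uu. assert (Ez : gate U z = m).
    { apply gate_uniq; auto. rewrite (dist_sym Hg), (dist_sym Hg z). auto. }
    pose proof (gate_le z GU Uu) as L. rewrite Ez in L. tri m z u. lia. }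
  assert (Fin : forall b v w, V1 v -> ~ Z v -> V2 w -> ~ Z w -> adj z v -> adj z w ->
     d b z = S (d b v) -> d b w = d b v ->
     exists z v w y, Z z /\ V1 v /\ ~ Z v /\ V2 w /\ ~ Z w /\ adj z v /\ adj z w /\
       adj y v /\ adj y w /\ y <> z).
  { intros b v w Vv Nv Ww Nw Av Aw Hb Hw.
    destruct (@qc b v w z (d b v)) as (_ & y & Y1 & Y2 & Y3); auto; try aj.
    { intros ->. auto. }
    exists z, v, w, y. repeat (split; [assumption|]). intros ->. lia. }
  destruct (@nearby_direction U Z V1 m z u1) as (v & Vv & Nv & Av & Dv); auto.
  destruct (@nearby_direction U Z V2 m z u2) as (w & Ww & Nw & Aw & Dw); auto.
  destruct Dv as [Dv|(a & Ua & Aa & Da)]; destruct Dw as [Dw|(b & Ub & Ab & Db)].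
  - apply (Fin m v w); auto; lia.
  - pose proof (Eu b Ub). base m. base b. tri b m v. apply (Fin b v w); auto; lia.
  - pose proof (Eu a Ua). base m. base a. tri a m w. apply (Fin a v w); auto; lia.
  - pose proof (Eu a Ua). pose proof (Eu b Ub). base m.
    destruct (d a b) as [|[|n]] eqn:Dab.
    + apply (dist_eq0 Hg) in Dab. subst b. apply (Fin a v w); auto; lia.
    + apply (adj_dist Hg) in Dab. destruct (eq_nat_dec (d b v) (d b w)) as [E|E].
      { apply (Fin b v w); auto; lia. }
      assert (Ebv : d b v = d b z) by (base b; base v; lia).
      (* Here [v] is not nearer to [b] than [z]; it is replaced by a point [v'] of the line [zv]
         that is. *)
      destruct (@tc b v z (d b w)) as (v' & V1' & V2' & V3'); auto; try aj; try lia.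
      apply (Fin b v' w); auto; try aj; try lia.
      * apply NNPP. intros N. assert (gate V1 v' = v) by (apply gate_nbr; auto; aj).
        assert (gate V1 v' = z) by (apply gate_nbr; auto; aj). congruence.
      * intros Zv'. assert (gate Z v = z) by (apply gate_nbr; auto; aj).
        assert (gate Z v = v') by (apply gate_nbr; auto; aj). subst. irr.
    + assert (n = 0) by (tri a b m; lia). subst n.
      destruct (@bpair_two_nbrs a b) as (c1 & c2 & Nc & A1 & A2 & A3 & A4); auto.
      { apply BU; auto. }
      (* A midpoint of [a] and [b] other than [m] is two steps from [m] and serves as base point. *)
      assert (exists x, x <> m /\ adj a x /\ adj x b) as (x & Nx & X1 & X2).
      { destruct (classic (c1 = m)) as [->|]; [exists c2|exists c1]; auto. }
      assert (Ux : U x).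
      { apply (gated_convex GU Ua Ub). base a. lia. }
      assert (d m x = 2).
      { assert (d m x <> 0) by (intros E0; apply Nx; symmetry; apply (dist_eq0 Hg E0)).
        assert (d m x <> 1).
        { intros E1. apply (adj_dist Hg) in E1.
          assert (adj b a); [|base a; lia].
          apply (@no_K4minus m x a b); try aj. intros ->. rewrite (dist_refl Hg) in Dab. lia. }
        base m. lia. }
      pose proof (Eu x Ux). base x. tri x b w. tri x a v. base v. base w.
      apply (Fin x v w); auto; lia.
Qed.

(** [X] is the hull of [y] and an antipode in [Z] of [z], for a square [z v y w]; it contains
    diametral pairs of both covers. *)
Lemma qc_above U Z V1 V2 : bset U -> bset Z -> bset V1 -> bset V2 -> cov Z V1 -> cov Z V2 ->
  V1 <> V2 -> bdist U Z = S (bdist U V1) -> bdist U V2 = bdist U V1 ->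
  exists X, bset X /\ cov V1 X /\ cov V2 X /\ bdist U V1 = S (bdist U X).
Proof.
  intros BU BZ B1 B2 C1 C2 N E1 E2.
  destruct (bdist_parity BU BZ B1 C1) as [[? _]|[_ (u1 & U1 & N1)]]; [lia|].
  destruct (bdist_parity BU BZ B2 C2) as [[? _]|[_ (u2 & U2 & N2)]]; [lia|].
  assert (NI : forall x, V1 x -> V2 x -> Z x).
  { intros x Vx Wx. apply NNPP. intros Nz. apply N. apply (@cov_inter_eq Z V1 V2 x); auto. }
  pose proof (bset_gated BZ) as GZ. pose proof (bset_gated B1) as G1. pose proof (bset_gated B2) as G2.
  pose proof C1 as [I1 R1]. pose proof C2 as [I2 R2].
  destruct (@square_above U Z V1 V2 u1 u2)
    as (z & v & w & y & Zz & Vv & Nv & Ww & Nw & Av & Aw & Yv & Yw & Nyz); auto.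
  destruct (antipode BZ Zz) as (z' & Zz' & Hz').
  assert (Nvw : v <> w) by (intros ->; auto).
  assert (By : bpair z' y).
  { apply (@bpair_closed z' v w y); auto; try aj; [apply B1|apply B2]; auto. }
  assert (Ny : ~ V1 y).
  { intros Vy. assert (Nw1 : ~ V1 w) by auto.
    assert (gate V1 w = z) by (apply gate_nbr; auto).
    assert (gate V1 w = y) by (apply gate_nbr; auto). congruence. }
  assert (Hv : d z' v = S (rk Z)).
  { pose proof (gate_le v GZ Zz'). rewrite (gate_nbr GZ Zz Nv Av) in H. base z. tri z' v z. lia. }
  assert (Hw : d z' w = S (rk Z)).
  { pose proof (gate_le w GZ Zz'). rewrite (gate_nbr GZ Zz Nw Aw) in H. base z. tri z' w z. lia. }
  assert (Hy : d z' y = S (S (rk Z))).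
  { pose proof (gate_le y G1 (I1 z' Zz')). rewrite (@gate_nbr V1 v y) in H; auto; try aj.
    base y. tri z' v y. lia. }
  destruct (bpair_bset By) as (X & BX & Xz & Xy & RX).
  assert (Xv : X v) by (apply (gated_convex (bset_gated BX) Xz Xy); base y; lia).
  assert (Xw : X w) by (apply (gated_convex (bset_gated BX) Xz Xy); base y; lia).
  assert (CX1 : cov V1 X) by (split; [apply (@hull_min V1 X z' v); auto|]; lia).
  assert (CX2 : cov V2 X) by (split; [apply (@hull_min V2 X z' w); auto|]; lia).
  exists X. split; [auto|]. split; [auto|]. split; [auto|].
  (* If the value rose, every gate in [X] of a point of [U] would lie in [V1] and [V2], hence in
     [Z], against the choice of [u1]. *)
  destruct (bdist_parity BU B1 BX CX1) as [[D1 F1]|[? _]]; [|auto].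
  destruct (bdist_parity BU B2 BX CX2) as [[_ F2]|[? _]]; [|lia].
  exfalso. apply N1. destruct CX1 as [J1 _]. rewrite (@gate_sub_eq V1 X); auto.
Qed.

(** * The barycentric graph *)

Lemma induced_walk (X : V -> Prop) (Cv : forall x y z, X x -> X y -> le x z y -> X z) n
  (a b : {x : V | X x}) : d (proj1_sig a) (proj1_sig b) = n -> walk (induced_adj adj X) n a b.
Proof.
  revert a. induction n as [|n IH]; intros [x Xx] E; simpl in E.
  - destruct b as [y Xy]; simpl in E. apply (dist_eq0 Hg) in E. subst y.
    rewrite (proof_irrelevance _ Xx Xy). constructor.
  - destruct (@geodesic_step _ _ Hg x (proj1_sig b) n E) as (z & A & Hz).
    assert (Xz : X z).
    { apply (Cv x (proj1_sig b)); auto; [apply proj2_sig|]. base x. lia. }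
    apply walkS with (exist _ z Xz); [exact A|]. apply IH. exact Hz.
Qed.

Lemma induced_dist (X : V -> Prop) (Cv : forall x y z, X x -> X y -> le x z y -> X z)
  (a b : {x : V | X x}) : dist (induced_adj adj X) a b = d (proj1_sig a) (proj1_sig b).
Proof.
  assert (G : is_graph (induced_adj adj X)).
  { split; [|split].
    - intros x y A. apply (adj_sym Hg A).
    - intros x A. apply (adj_irrefl Hg A).
    - intros x y. exists (d (proj1_sig x) (proj1_sig y)). apply induced_walk; auto. }
  apply Nat.le_antisymm.
  - apply (dist_le G). apply induced_walk; auto.
  - apply (dist_le Hg). generalize (dist_walk G a b).
    generalize (dist (induced_adj adj X) a b). intros n W.
    induction W as [|n a c b A W IH]; [constructor|]. apply walkS with (proj1_sig c); auto.
Qed.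

(** A cycle vertex equal to [u] or [v] has both cycle neighbours strictly between them, so one
    diagonal consists of two midpoints. *)
Lemma thick_two_nbrs (X : V -> Prop) u v : (forall x y z, X x -> X y -> le x z y -> X z) ->
  thick (induced_adj adj X) -> X u -> X v -> d u v = 2 ->
  exists a b, a <> b /\ adj u a /\ adj a v /\ adj u b /\ adj b v.
Proof.
  intros Cv Th Xu Xv E.
  destruct (Th (exist _ u Xu) (exist _ v Xv)) as ([x1 ?] & [x2 ?] & [x3 ?] & [x4 ?] & L1 & L2 & L3 & L4 & C).
  { rewrite induced_dist; auto. }
  unfold interval in *. rewrite !induced_dist in *; auto. simpl in *.
  destruct C as (A12 & A23 & A34 & A41 & _ & _ & N13 & N24). unfold induced_adj in *; simpl in *.
  assert (N13' : x1 <> x3).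
  { intros ->. apply N13. f_equal. apply proof_irrelevance. }
  assert (N24' : x2 <> x4).
  { intros ->. apply N24. f_equal. apply proof_irrelevance. }
  assert (P : forall t, d u t + d t v = d u v -> t = u \/ t = v \/ (adj u t /\ adj t v)).
  { intros t L. assert (D : d u t = 0 \/ d t v = 0 \/ (d u t = 1 /\ d t v = 1)) by lia.
    destruct D as [D|[D|[D D']]].
    - left. symmetry. apply (dist_eq0 Hg D).
    - right; left. apply (dist_eq0 Hg D).
    - right; right. split; apply (adj_dist Hg); auto. }
  assert (Nuv : ~ adj u v) by (intros A; base u; lia).
  assert (Nvu : ~ adj v u) by (intros A; base u; lia).
  destruct (P x1 L1) as [->|[->|[]]]; destruct (P x2 L2) as [->|[->|[]]];
    try irr; try contradiction;
    destruct (P x3 L3) as [->|[->|[]]]; try irr; try contradiction;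
    destruct (P x4 L4) as [->|[->|[]]]; try irr; try contradiction;
    try (exists x1, x3; repeat split; solve [auto]);
    try (exists x2, x4; repeat split; solve [auto]).
Qed.

Lemma boolean_gated_iff (v0 : V) X : boolean_gated adj X /\ finite_diameter adj X <-> bset X.
Proof.
  split.
  - intros [[G T] F]. split; [auto|]. split; [|split; auto].
    + apply thick_all_bpair; [apply gated_convex; auto|].
      intros u v Xu Xv E. apply (@thick_two_nbrs X u v); auto. apply gated_convex; auto.
    + destruct (G v0) as (x & Xx & _). eauto.
  - intros (G & B & F & _). split; auto. split; auto.
    pose proof (gated_convex G) as Cv. intros [u Xu] [v Xv] E.
    rewrite induced_dist in E; auto. simpl in E.
    destruct (@bpair_two_nbrs u v) as (a & b & N & A1 & A2 & A3 & A4); auto.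
    assert (Xa : X a) by (apply (Cv u v); auto; base u; lia).
    assert (Xb : X b) by (apply (Cv u v); auto; base u; lia).
    exists (exist _ u Xu), (exist _ a Xa), (exist _ v Xv), (exist _ b Xb).
    unfold interval. rewrite !induced_dist; auto. simpl.
    assert (~ adj a b).
    { apply (@qc u a b v 1); auto; base u; lia. }
    assert (~ adj u v) by (intros A; base u; lia).
    rewrite !(dist_refl Hg). base u. repeat split; try lia; try (simpl; aj).
    + intros Q. injection Q. intros Q'. rewrite Q', (dist_refl Hg) in E. lia.
    + intros Q. injection Q. auto.
Qed.

Notation star := (@star_adj V adj).
Notation set A := (@proj1_sig (V -> Prop) _ A).

Lemma BG_ext (A B : BG_vertex adj) : set A = set B -> A = B.
Proof.
  destruct A as [X HX], B as [Y HY]; simpl. intros ->. f_equal. apply proof_irrelevance.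
Qed.

Lemma star_sym (A B : BG_vertex adj) : star A B -> star B A.
Proof. intros [H|H]; [right|left]; auto. Qed.

Lemma strict_subset_asym (X Y : V -> Prop) : strict_subset X Y -> ~ incl Y X.
Proof. intros [_ (y & Yy & N)] I. auto. Qed.

Lemma covers_asym (A B : BG_vertex adj) : covers A B -> ~ covers B A.
Proof. intros [H _] [[I _] _]. apply (strict_subset_asym H I). Qed.

Lemma star_irrefl (A : BG_vertex adj) : ~ star A A.
Proof. intros [H|H]; apply (covers_asym H H). Qed.

Section Inhabited.
Variable v0 : V.

Lemma BG_bset (A : BG_vertex adj) : bset (set A).
Proof. apply (boolean_gated_iff v0). apply proj2_sig. Qed.

Local Hint Resolve BG_bset : core.

Lemma bset_BG X : bset X -> exists A : BG_vertex adj, set A = X.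
Proof.
  intros B. apply (boolean_gated_iff v0) in B. exists (exist _ X B). reflexivity.
Qed.

Lemma covers_iff (A B : BG_vertex adj) : covers A B <-> cov (set A) (set B).
Proof.
  split.
  - intros [[I (x & Bx & Nx)] N]. change (incl (set A) (set B)) in I.
    destruct (@cov_between (set A) (set B) x) as (Y & BY & J & C); auto.
    destruct (classic (exists y, Y y /\ ~ set A y)) as [(y & Yy & Ny)|F].
    + exfalso. apply N. destruct (bset_BG BY) as [D <-]. exists D. split; split; auto.
      * eauto.
      * apply C.
      * apply cov_proper; auto.
    + replace (set A) with Y; auto. apply set_ext. intros y. split; auto.
      intros Yy. apply NNPP. eauto.
  - intros C. split.
    + split; [apply C|]. apply cov_proper; auto.
    + intros (D & [I1 (x & Dx & Nx)] & [I2 (y & By & Ny)]).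
      pose proof (rk_lt (BG_bset D) (BG_bset A) I1 Dx Nx).
      pose proof (rk_lt (BG_bset B) (BG_bset D) I2 By Ny). destruct C as [_ C]. lia.
Qed.

Lemma star_iff (A B : BG_vertex adj) : star A B <-> cov (set A) (set B) \/ cov (set B) (set A).
Proof. unfold star_adj. rewrite !covers_iff. tauto. Qed.

Lemma bdist_self X : bset X -> bdist X X = 0.
Proof.
  intros B. pose proof (bset_gated B) as G.
  assert (E : proj X X = X).
  { apply set_ext. intros x. split; [apply proj_in; auto|].
    intros Xx. exists x. split; auto. symmetry. apply gate_id; auto. }
  destruct B as (_ & _ & _ & x & Xx).
  assert (sdist X X = 0).
  { apply sdist_eq; [|intros; lia]. exists x. rewrite gate_id; auto. split; auto. apply (dist_refl Hg). }
  unfold bdist. rewrite E. lia.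
Qed.

Lemma bdist_step (U A B : BG_vertex adj) : star A B ->
  bdist (set U) (set B) = S (bdist (set U) (set A)) \/
  bdist (set U) (set A) = S (bdist (set U) (set B)).
Proof.
  rewrite star_iff. intros [C|C].
  - destruct (bdist_parity (BG_bset U) (BG_bset A) (BG_bset B) C) as [[]|[]]; auto.
  - destruct (bdist_parity (BG_bset U) (BG_bset B) (BG_bset A) C) as [[]|[]]; auto.
Qed.

Lemma bdist_walk (U A : BG_vertex adj) : walk star (bdist (set U) (set A)) A U.
Proof.
  apply (@potential_descend _ star (fun A => bdist (set U) (set A))).
  - intros B N. destruct (@bdist_descend (set U) (set B)) as (Y & BY & C & E); auto.
    { intros Q. apply N, BG_ext, Q. }
    destruct (bset_BG BY) as [D <-]. exists D. split; auto. apply star_iff. tauto.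
  - apply bdist_self; auto.
Qed.

Lemma star_is_graph : is_graph star.
Proof.
  split; [exact star_sym|]. split; [exact star_irrefl|].
  intros A B. exists (bdist (set B) (set A)). apply bdist_walk.
Qed.

Lemma star_dist (U A : BG_vertex adj) : dist star U A = bdist (set U) (set A).
Proof.
  apply Nat.le_antisymm.
  - apply (dist_le star_is_graph). apply (walk_rev star_sym), bdist_walk.
  - pose proof (@potential_walk _ star (fun A => bdist (set U) (set A)) U) as H.
    specialize (H ltac:(intros B C Q; destruct (bdist_step U Q); lia) _ _ (dist_walk star_is_graph U A)).
    cbv beta in H. rewrite bdist_self in H; auto. lia.
Qed.

Lemma star_modular_inhabited : modular_graph star.
Proof.
  apply (modular_of_quadrangle star_is_graph).
  - intros U A B Q. rewrite !star_dist. destruct (bdist_step U Q); lia.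
  - intros U A B C QA QB N. rewrite !star_dist. intros E1 E2.
    assert (N' : set A <> set B) by (intros Q; apply N, BG_ext, Q).
    assert (E3 : bdist (set U) (set C) = S (bdist (set U) (set B))) by lia.
    pose proof (BG_bset U). pose proof (BG_bset A). pose proof (BG_bset B). pose proof (BG_bset C).
    assert (exists X, bset X /\ (cov X (set A) \/ cov (set A) X) /\ (cov X (set B) \/ cov (set B) X) /\
      bdist (set U) (set A) = S (bdist (set U) X)) as (X & BX & C1 & C2 & E).
    { apply star_iff in QA, QB. destruct QA as [QA|QA], QB as [QB|QB].
      - destruct (@qc_below (set U) (set C) (set A) (set B)) as (X & ? & ? & ? & ?); auto.
        exists X; auto.
      - destruct (@qc_through (set U) (set C) (set A) (set B)) as (X & ? & ? & ? & ?); auto.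
        exists X; auto.
      - destruct (@qc_through (set U) (set C) (set B) (set A)) as (X & ? & ? & ? & ?); auto.
        exists X. do 3 (split; [auto|]). lia.
      - destruct (@qc_above (set U) (set C) (set A) (set B)) as (X & ? & ? & ? & ?); auto.
        exists X; auto. }
    destruct (bset_BG BX) as [D <-]. exists D. rewrite !star_iff, star_dist. auto.
Qed.

(** * Admissibility and the embedding of singletons *)

Lemma no_cov_K22 X1 X2 Y1 Y2 : bset X1 -> bset X2 -> bset Y1 -> bset Y2 ->
  cov X1 Y1 -> cov X1 Y2 -> cov X2 Y1 -> cov X2 Y2 -> X1 <> X2 -> Y1 <> Y2 -> False.
Proof.
  intros B1 B2 D1 D2 C1 C2 C3 C4 NX NY.
  assert (exists x, X2 x /\ ~ X1 x) as (x & H1 & H2).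
  { apply NNPP. intros F. apply NX, set_ext.
    assert (J : incl X2 X1) by (intros y Ay; apply NNPP; eauto).
    assert (J' : incl X1 X2) by (apply rk_eq_incl; auto; destruct C1, C3; lia).
    intros y; split; auto. }
  apply NY, (@cov_inter_eq X1 Y1 Y2 x); auto; [apply C3|apply C4]; auto.
Qed.

(** By ranks, the only non-parallel pattern alternates two lower and two upper sets, which
    [no_cov_K22] excludes. *)
Lemma square_parallel (A1 A2 A3 A4 : BG_vertex adj) :
  star A2 A3 -> star A3 A4 -> star A4 A1 -> A1 <> A3 -> A2 <> A4 -> covers A1 A2 -> covers A4 A3.
Proof.
  rewrite !star_iff, !covers_iff. intros Q23 Q34 Q41 N13 N24 C12.
  destruct Q34 as [Q34|Q34]; auto. exfalso.
  pose proof (proj2 C12). pose proof (proj2 Q34).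
  destruct Q23 as [Q23|Q23], Q41 as [Q41|Q41];
    pose proof (proj2 Q23); pose proof (proj2 Q41); try lia.
  apply (@no_cov_K22 (set A1) (set A3) (set A2) (set A4)); auto;
    intros Q; [apply N13|apply N24]; apply BG_ext, Q.
Qed.

Lemma singleton_bset p : bset (fun x => x = p).
Proof.
  split; [|split; [|split]].
  - intros x. exists p. split; auto. intros y ->. unfold interval. rewrite (dist_refl Hg). lia.
  - intros x y E1 E2. rewrite E1, E2. constructor.
  - exists 0. intros x y E1 E2. rewrite E1, E2, (dist_refl Hg). lia.
  - eauto.
Qed.

Lemma bdist_singleton p q : bdist (fun x => x = p) (fun x => x = q) = 2 * d p q.
Proof.
  pose proof (singleton_bset p) as Bp. pose proof (singleton_bset q) as Bq.
  assert (rk0 : forall p, rk (fun x => x = p) = 0).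
  { intros r. apply rk_eq; [apply singleton_bset|]. split.
    - intros x y E1 E2. rewrite E1, E2, (dist_refl Hg). lia.
    - exists r, r. rewrite (dist_refl Hg). auto. }
  assert (Eg : forall u, gate (fun x => x = q) u = q).
  { intros u. apply (gate_in u (bset_gated Bq)). }
  assert (Es : sdist (fun x => x = p) (fun x => x = q) = d p q).
  { apply sdist_eq; [exists p; rewrite Eg; auto|]. intros u ->. rewrite Eg. auto. }
  pose proof (rk_proj_le Bp Bq). unfold bdist. rewrite Es, !rk0 in *. lia.
Qed.

End Inhabited.

Lemma hasse_admissible : admissible star (@hasse_orientation V adj).
Proof.
  unfold hasse_orientation. split.
  - split; [|split].
    + intros A B C. left; auto.
    + intros A B Q. auto.
    + intros A B C. apply covers_asym; auto.
  - intros A1 A2 A3 A4 (Q12 & Q23 & Q34 & Q41 & _ & _ & N13 & N24).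
    assert (exists v0 : V, True) as [v0 _].
    { apply NNPP. intros F. apply N13, BG_ext, set_ext. intros x. exfalso. eauto. }
    pose proof (@square_parallel v0) as P.
    pose proof (star_sym Q12). pose proof (star_sym Q23).
    pose proof (star_sym Q34). pose proof (star_sym Q41).
    split; [|split; [|split]]; split; intros C; refine (P _ _ _ _ _ _ _ _ _ C); auto.
Qed.

(** An empty [V] is treated apart, because [bset] excludes the empty set; all vertices of G* then
    coincide. *)
Lemma star_modular : modular_graph star.
Proof.
  destruct (classic (exists v0 : V, True)) as [[v0 _]|F]; [apply (star_modular_inhabited v0)|].
  assert (E : forall A B : BG_vertex adj, A = B).
  { intros A B. apply BG_ext, set_ext. intros x. exfalso. eauto. }
  assert (G : is_graph star).
  { split; [exact star_sym|]. split; [exact star_irrefl|].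
    intros A B. rewrite (E A B). exists 0. constructor. }
  split; auto. intros A B C. rewrite (E A C), (E B C). exists C. unfold interval.
  rewrite (dist_refl G). auto.
Qed.

End SwmLocal.

Theorem theorem6p10 (V : Type) (adj : V -> V -> Prop) :
  swm_graph adj ->
  modular_graph (@star_adj V adj) /\
  orientable (@star_adj V adj) /\
  admissible (@star_adj V adj) (@hasse_orientation V adj) /\
  (forall p : V, exists X : BG_vertex adj, forall x, proj1_sig X x <-> x = p) /\
  (forall (p q : V) (X Y : BG_vertex adj),
     (forall x, proj1_sig X x <-> x = p) ->
     (forall y, proj1_sig Y y <-> y = q) ->
     dist (@star_adj V adj) X Y = 2 * dist adj p q).
Proof.
  intros Hs. pose proof (hasse_admissible Hs) as Ad.
  split; [apply star_modular; auto|].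
  split; [exists (@hasse_orientation V adj); auto|].
  split; [auto|]. split.
  - intros p. destruct (bset_BG Hs p (singleton_bset Hs p)) as [X HX].
    exists X. rewrite HX. tauto.
  - intros p q X Y HX HY. rewrite (star_dist Hs p).
    rewrite (set_ext HX), (set_ext HY). apply bdist_singleton; auto.
Qed.
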